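(* Let $T$ be a tree on $n$ vertices. If $n$ is even, then $m(T)=n-1$. If $n$ is odd, then $m(T)\ge n-65$.
   Context: Let $G$ be a finite graph on $n$ vertices whose vertices are colored with two colors (red and blue) in an unknown way. A vertex is a majority vertex if its color class contains more than $n/2$ vertices. A query is an edge $uv$ of $G$; the answer tells whether $u$ and $v$ have the same color (SAME) or different colors (DIFF). Queries are adaptive (each query may depend on the previous answers), and the algorithm is deterministic. The majority problem on $G$ is to find a majority vertex or to show that none exists. $m(G)$ denotes the least number of queries needed in the worst case (over all colorings) to solve the majority problem on $G$. *)

(* Defs.v *)
From mathcomp Require Import all_boot.
From mathcomp Require Import boolp.

Set Implicit Arguments.
Unset Strict Implicit.
Unset Printing Implicit Defensive.

Section Trees.
Variables (V : finType) (e : rel V).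

Definition simple_graph : Prop := symmetric e /\ irreflexive e.

Definition connected_graph : Prop := 0 < #|V| /\ forall x y : V, connect e x y.

(* [ucycle e [:: x; y]] holds as soon as [e] is symmetric and [e x y], so that
   genuine cycles are those of length at least 3. *)
Definition acyclic_graph : Prop := forall p : seq V, ucycle e p -> size p <= 2.

Definition is_tree : Prop :=
  [/\ simple_graph, connected_graph & acyclic_graph].

End Trees.

Section Majority.
Variable V : finType.

Definition coloring : Type := {ffun V -> bool}.

Definition majority_vertex (c : coloring) (v : V) : bool :=
  #|V| < 2 * #|[set w | c w == c v]|.

(* [Query u v s d] asks about the pair [uv] and goes on with [s] if the answer
   is SAME, with [d] if it is DIFF. [Output (Some v)] claims that [v] is a
   majority vertex, [Output None] that there is none. *)
Inductive algorithm : Type :=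
| Output of option V
| Query of V & V & algorithm & algorithm.

Fixpoint queries_edges (e : rel V) (a : algorithm) : bool :=
  match a with
  | Output _ => true
  | Query u v s d => [&& e u v, queries_edges e s & queries_edges e d]
  end.

Fixpoint run (a : algorithm) (c : coloring) : option V :=
  match a with
  | Output o => o
  | Query u v s d => if c u == c v then run s c else run d c
  end.

Fixpoint num_queries (a : algorithm) (c : coloring) : nat :=
  match a with
  | Output _ => 0
  | Query u v s d =>
      (if c u == c v then num_queries s c else num_queries d c).+1
  end.

Definition correct_output (c : coloring) (o : option V) : Prop :=
  match o with
  | Some v => majority_vertex c v
  | None => forall v, ~~ majority_vertex c v
  end.

Definition solves_majority (e : rel V) (a : algorithm) : Prop :=
  queries_edges e a /\ forall c, correct_output c (run a c).

Definition solvable_within (e : rel V) (k : nat) : Prop :=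
  exists2 a, solves_majority e a & forall c, num_queries a c <= k.

(* The value is 0 by convention when no algorithm solves the majority problem.
   This can only happen for disconnected graphs: when the graph is connected,
   the answers on all edges determine the coloring up to swapping the colors. *)
Definition m (e : rel V) : nat :=
  match pselect (exists k, `[< solvable_within e k >]) with
  | left solvable => ex_minn solvable
  | right _ => 0
  end.

Lemma m_least (e : rel V) (k : nat) :
  solvable_within e k -> solvable_within e (m e) /\ m e <= k.
Proof.
move=> ek; rewrite /m; case: pselect => [exk|[]]; last by exists k; apply/asboolP.
by case: ex_minnP => j /asboolP ej minj; split=> //; apply/minj/asboolP.
Qed.

End Majority.

(* Main.v *)
Require Import Defs.
From mathcomp Require Import all_boot all_order all_algebra zify.

(** The upper bound is clear: the answers on all n - 1 edges of the tree
    determine the coloring up to swapping the colors. The lower bounds come from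
    an adversary.

    The tree is rooted, so that an edge is a vertex x other than the root, joined
    to [par x]. The answered edges F cut the tree into blocks, one for each
    vertex t outside F (the top of the block), and only the block
    discrepancies matter: flipping any set of blocks of a coloring c leaves all
    answers on F unchanged. The weight of a block is the absolute value of its
    discrepancy, and a query merges two blocks of weights a and b into one whose
    weight the adversary chooses to be a + b or |a - b| ([merge_wt]). Lemma
    [adversary] reduces a lower bound to an invariant P of F and a coloring c
    that survives each such step and that excludes a correct output.

    The first strategy ([tame]) makes the weight of a block a function of the
    block alone: 1 if it has odd size, else 2 or 0 according to the parity of the
    sum of the tree degrees of its vertices. Sizes and degree sums add up, so
    this can be maintained. The point is that a block of weight 0 cannot be a
    leaf of the tree of blocks ([zero_blk_child]). If n is even and two blocks
    are left, then a lowest block has positive weight, so that some coloring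
    has a majority, while the blocks can also be flipped into perfect balance
    ([balanced_flip], again by the degree sum): no output is correct. Hence all
    n - 1 edges are needed.

    If n is odd there is always a majority, and only its location is in doubt.
    Here the adversary controls the parity of the number of ways to choose the
    signs of the weights so that the total discrepancy is negative, where the
    signs of a few reference blocks are fixed ([negpar], [undecided]). Splitting
    the sign patterns of two weights a and b into those with equal and those with
    opposite signs shows that the number for a, b is the sum of the numbers for
    a + b and for |a - b|, and that opposite signs contribute an even number if
    a = b ([negpar_merge]). So an odd number stays odd for one of the two
    answers, and no new block of weight 0 arises ([parity_step]). If some output v
    is correct, then the sign of the total depends only on whether the block
    of v is flipped, and the number of negative patterns is even as soon as two
    blocks other than the reference blocks have positive weight ([parity_stop]).
    So the algorithm cannot stop before at most one such block is left, apart
    from blocks of weight 0.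

    Two things remain. First, the parity must be odd at some time. It is
    when the sum of all weights is 2^(k+2) + 1 or 2^(k+2) + 3 and there are enough
    weights 1 and 2 outside the reference blocks ([negpar_start]), because
    2^k weights 2 act modulo 2 as a single weight 2^(k+1). The adversary
    therefore starts with the first strategy; a step lowers the sum of the weights
    by at most 4, and this sum is always odd, so that it hits one of the two
    values. Second, blocks of weight 0 must be few. For this the first strategy
    gives positive weight to every block with a marked vertex, where the root
    and the vertices in one sparse residue class of depths modulo 20 are marked.
    Then the top of a block of weight 0 lies less than 20 levels above the top of
    some other block, which is not made up of such blocks ([stale_below],
    [stale_below_near]). At most 4 blocks of the latter kind are left, at most 3
    reference blocks and one other, and the block of the root is among them but
    lies below no block. So at most 4 + 19 * 3 = 61 blocks are left when the
    algorithm stops ([card_tops_le]). *)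

Set Implicit Arguments.
Unset Strict Implicit.
Unset Printing Implicit Defensive.

Import GRing.Theory Num.Theory Order.TTheory.

(** * Rooting a tree *)

Section RootedTree.
Variables (V : finType) (e : rel V).

Definition rooting (r : V) (par : V -> V) (dep : V -> nat) : Prop :=
  (forall v, v != r -> dep v = (dep (par v)).+1) /\
  (forall u v, e u v = ((u != r) && (v == par u)) || ((v != r) && (u == par v))).

(** Depths are distances from the root r, and the parent of v is a
    neighbor of v closer to r. An edge of another kind would close a cycle
    together with a simple path along parent edges. *)
Lemma tree_rooting : is_tree e -> exists r par dep, rooting r par dep.
Proof.
case=> -[symE irrE] [] /card_gt0P [r _] conn acyc.
pose reach k v := [exists p : k.-tuple V, path e r p && (last r p == v)].
have ex_reach v : exists k, reach k v.
  have /connectP [p pp ->] := conn r v.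
  by exists (size p); apply/existsP; exists (in_tuple p); rewrite /= pp eqxx.
pose dep v := ex_minn (ex_reach v).
have dep_le k v : reach k v -> dep v <= k.
  by rewrite /dep; case: ex_minnP => j _ minj /minj.
have depP v : reach (dep v) v by rewrite /dep; case: ex_minnP.
have ex_par v : v != r -> exists u, e v u && (dep v == (dep u).+1).
  move=> vr; have /existsP [p /andP [pp /eqP lp]] := depP v.
  have sp := size_tuple p; case/lastP: (tval p) pp lp sp => [|p' y].
    by move=> _ /= rv; rewrite rv eqxx in vr.
  rewrite rcons_path last_rcons size_rcons => /andP [pp' ey] yv; rewrite yv in ey *.
  move=> sp; exists (last r p'); rewrite symE ey /=.
  rewrite eqn_leq; apply/andP; split.
    apply: dep_le; apply/existsP.
    have /existsP [p2 /andP [pp2 /eqP lp2]] := depP (last r p').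
    exists [tuple of rcons p2 v].
    by rewrite rcons_path pp2 lp2 ey last_rcons eqxx.
  by rewrite -sp ltnS; apply: dep_le; apply/existsP; exists (in_tuple p'); rewrite /= pp' eqxx.
pose par v := if v == r then r else
  if [pick u | e v u && (dep v == (dep u).+1)] is Some u then u else r.
have parP v : v != r -> e v (par v) && (dep v == (dep (par v)).+1).
  move=> vr; rewrite /par (negbTE vr); case: pickP => [u //|none].
  by have [u] := ex_par v vr; rewrite none.
have par_dep v : v != r -> dep v = (dep (par v)).+1 by move=> /parP /andP [_ /eqP].
exists r, par, dep; split => //.
pose up u v := ((u != r) && (v == par u)) || ((v != r) && (u == par v)).
have up_e : subrel up e.
  move=> u v /orP [] /andP [/parP /andP [ev _] /eqP ->] //.
  by rewrite symE.
have up_sym : symmetric up by move=> u v; rewrite /up orbC.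
have up_root v : connect up v r.
  elim: {v}(dep v) {-2}v (erefl (dep v)) => [|k IH] v dv.
    have [->|/par_dep] := eqVneq v r; first exact: connect0.
    by rewrite dv.
  have [->|vr] := eqVneq v r; first exact: connect0.
  apply: connect_trans (connect1 _) (IH (par v) _); first by rewrite /up vr eqxx.
  by move: (par_dep v vr); rewrite dv => -[].
(* The edge u v closes a cycle with a simple path p from u to v along parent edges. *)
move=> u v; rewrite -/(up u v); apply/idP/idP => [euv|/up_e //]; apply/negPn/negP => nup.
have /connectP [p0 pp0 lp0] : connect up u v.
  by apply: connect_trans (up_root u) _; rewrite (sym_connect_sym up_sym).
move: lp0; case/shortenP: pp0 => p pp up_ _ lp.
have := acyc (u :: p); case: p pp up_ lp => [|a [|b p]] pp up_ lp.
- by move: euv; rewrite lp /= irrE.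
- by move: nup; rewrite lp /=; move: pp; rewrite /= andbT => ->.
move=> H; suff : ucycle e [:: u, a, b & p] by move/H.
rewrite /ucycle up_ andbT /cycle rcons_path (sub_path up_e pp) -lp.
by rewrite symE.
Qed.
End RootedTree.

(** * Blocks: the components of the answered edges *)

Section Blocks.
Variables (V : finType) (r : V) (par : V -> V) (dep : V -> nat).
Hypothesis dep_par : forall v, v != r -> dep v = (dep (par v)).+1.

(** Induction on the depth. *)
Lemma ancestor_ind (P : V -> Prop) :
  (forall v, (v != r -> P (par v)) -> P v) -> forall v, P v.
Proof.
move=> step v; elim: {v}(dep v) {-2}v (leqnn (dep v)) => [|k IH] v dv.
  by apply: step => vr; move: dv; rewrite dep_par.
by apply: step => vr; apply: IH; move: dv; rewrite dep_par.
Qed.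

Definition climb (F : {set V}) v := if v \in F then par v else v.
(** The block of v is named by its highest vertex, which is reached by climbing
    along edges in F; if r is not in F, then [dep v] rounds suffice, and further
    ones change nothing. *)
Definition top (F : {set V}) v := iter (dep v) (climb F) v.
Definition blk (F : {set V}) t := [set v | top F v == t].

Implicit Types (F : {set V}) (t u v x : V).

Lemma top_id F v : v \notin F -> top F v = v.
Proof.
by move=> vF; rewrite /top; elim: (dep v) => //= k ->; rewrite /climb (negbTE vF).
Qed.

Section Forest.
Variable F : {set V}.
Hypothesis rF : r \notin F.

Lemma mem_neq_root v : v \in F -> v != r.
Proof. by apply: contraTneq => ->. Qed.

Lemma top_par v : v \in F -> top F v = top F (par v).
Proof.
move=> vF; rewrite /top dep_par ?mem_neq_root // iterSr.
by rewrite /climb vF.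
Qed.

Lemma top_notin v : top F v \notin F.
Proof.
elim/ancestor_ind: v => v IH; have [vF|vF] := boolP (v \in F).
  by rewrite top_par // IH // mem_neq_root.
by rewrite top_id.
Qed.

Lemma dep_top v : dep (top F v) <= dep v.
Proof.
elim/ancestor_ind: v => v IH; have [vF|vF] := boolP (v \in F).
  have vr := mem_neq_root vF.
  by rewrite top_par // (dep_par vr); apply: leq_trans (IH vr) _.
by rewrite top_id.
Qed.

Lemma top_par_neq x : x != r -> top F (par x) != x.
Proof.
move=> xr; apply/eqP => eqx; have := dep_top (par x).
by rewrite eqx dep_par // ltnn.
Qed.

Lemma mem_blk_top t : t \notin F -> t \in blk F t.
Proof. by move=> tF; rewrite inE top_id. Qed.

Lemma root_notin_add x : x != r -> r \notin x |: F.
Proof. by move=> xr; rewrite !inE eq_sym negb_or xr. Qed.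

End Forest.

Section AddEdge.
Variables (F : {set V}) (x : V).
Hypotheses (rF : r \notin F) (xF : x \notin F) (xr : x != r).
Let rxF : r \notin x |: F. Proof. exact: root_notin_add. Qed.

(** Answering the edge x merges the block with top x into the block of
    [par x], which keeps its top. *)
Lemma top_add v :
  top (x |: F) v = if top F v == x then top F (par x) else top F v.
Proof.
elim/ancestor_ind: v => v IH; have [vF|vF] := boolP (v \in F).
  rewrite (top_par rF vF) (top_par rxF); last by rewrite !inE vF orbT.
  exact: IH (mem_neq_root rF vF).
rewrite (top_id vF); have [vx|vx] := eqVneq v x.
  rewrite {}vx in IH *; rewrite (top_par rxF) ?setU11 // IH // ifN //.
  exact: top_par_neq.
by rewrite top_id // !inE negb_or vx.
Qed.

Lemma blk_add t : t != top F (par x) -> t != x -> blk (x |: F) t = blk F t.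
Proof.
move=> tx tx'; apply/setP => v; rewrite !inE top_add.
case: (eqVneq (top F v) x) => [->|//].
by rewrite eq_sym (negbTE tx) eq_sym (negbTE tx').
Qed.

Lemma big_blk_merge (R : nmodType) (f : V -> R) :
  (\sum_(v in blk (x |: F) (top F (par x))) f v =
   \sum_(v in blk F (top F (par x))) f v + \sum_(v in blk F x) f v)%R.
Proof.
rewrite -bigU /=; last first.
  rewrite -setI_eq0; apply/eqP/setP => v; rewrite !inE.
  apply/negP => /andP [/eqP ->]; apply/negP; exact: top_par_neq.
apply: eq_bigl => v; rewrite !inE top_add.
case: (eqVneq (top F v) x) => [->|_]; first by rewrite eqxx orbT.
by rewrite orbF.
Qed.

Lemma card_blk_merge :
  #|blk (x |: F) (top F (par x))| = #|blk F (top F (par x))| + #|blk F x|.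
Proof. by rewrite -!sum1_card; exact: (big_blk_merge (fun=> 1%N)). Qed.

Lemma cardI_blk_merge (X : {set V}) :
  #|blk (x |: F) (top F (par x)) :&: X| =
  #|blk F (top F (par x)) :&: X| + #|blk F x :&: X|.
Proof.
have E (A : {set V}) : #|A :&: X| = \sum_(v in A) (v \in X).
  rewrite -sum1_card big_mkcond [RHS]big_mkcond /=.
  by apply: eq_bigr => v _; rewrite inE; case: (v \in A); case: (v \in X).
by rewrite !E; exact: (big_blk_merge (fun v => (v \in X) : nat)).
Qed.

End AddEdge.

(** * Colorings, discrepancies and flips of blocks *)

Definition sg (b : bool) : int := if b then 1%R else (-1)%R.
Definition disc (c : coloring V) (A : {set V}) : int := (\sum_(v in A) sg (c v))%R.
Definition wt F c t : nat := absz (disc c (blk F t)).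

(** Turns majorities into signs, so that an output is refuted by a
    coloring with a discrepancy of the wrong sign. *)
Lemma majority_disc (c : coloring V) v :
  majority_vertex c v = (0 < sg (c v) * disc c setT)%R.
Proof.
rewrite /majority_vertex; set A := [set w | _].
have -> : (sg (c v) * disc c setT = #|A|%:Z - #|~: A|%:Z)%R.
  rewrite /disc mulr_sumr (bigID (mem A)) /=; congr (_ + _)%R.
    rewrite -natz -sumr_const; apply: eq_big => [w|w]; first by rewrite inE.
    by move=> /andP [_ /=]; rewrite !inE => /eqP ->; case: (c v).
  rewrite -natz -sumr_const -sumrN; apply: eq_big => [w|w].
    by rewrite !inE.
  by move=> /andP [_ /=]; rewrite !inE; case: (c v); case: (c w).
have := cardsC A; lia.
Qed.

(** The colorings c and c' cannot be told apart by the answers on F. *)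
Definition same_answers F (c c' : coloring V) :=
  forall v, v \in F -> (c' v == c' (par v)) = (c v == c (par v)).

Lemma same_answers_refl F c : same_answers F c c. Proof. by []. Qed.
Lemma same_answers_trans F c1 c2 c3 :
  same_answers F c1 c2 -> same_answers F c2 c3 -> same_answers F c1 c3.
Proof. by move=> h1 h2 v vF; rewrite h2 // h1. Qed.

(** The block with top t is recolored if [eps t] holds. These are all the
    colorings with the same answers as c. *)
Definition flip F (eps : pred V) (c : coloring V) : coloring V :=
  [ffun v => c v (+) eps (top F v)].

Lemma same_answers_flip F eps c : r \notin F -> same_answers F c (flip F eps c).
Proof.
move=> rF v vF; rewrite !ffunE (top_par rF vF).
by case: (c v); case: (c (par v)); case: (eps _).
Qed.

Lemma disc_flip F eps c t :
  disc (flip F eps c) (blk F t) =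
  ((-1) ^+ eps t * disc c (blk F t))%R.
Proof.
rewrite /disc mulr_sumr; apply: eq_bigr => v; rewrite inE => /eqP vt.
by rewrite ffunE vt; case: (c v); case: (eps t); rewrite /= ?expr0 ?expr1 /sg /=.
Qed.

Lemma disc_setT F c : r \notin F ->
  disc c setT = (\sum_(t in ~: F) disc c (blk F t))%R.
Proof.
move=> rF; rewrite /disc (partition_big (top F) (mem (~: F))) /=; last first.
  by move=> v _; rewrite inE top_notin.
apply: eq_bigr => t _; apply: eq_bigl => v.
by rewrite !inE.
Qed.

Lemma odd_absD (x y : int) : odd `|(x + y)%R|%N = odd `|x|%N (+) odd `|y|%N.
Proof. lia. Qed.

Lemma odd_disc (c : coloring V) A : odd `|disc c A|%N = odd #|A|.
Proof.
rewrite /disc -sum1_card.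
elim/big_ind2: _ => // [a b a' b' IH1 IH2 | v _].
  by rewrite oddD odd_absD IH1 IH2.
by case: (c v).
Qed.

Lemma odd_wt F c t : odd (wt F c t) = odd #|blk F t|.
Proof. exact: odd_disc. Qed.

Lemma odd_sum_wt F c : r \notin F -> odd (\sum_(t in ~: F) wt F c t) = odd #|V|.
Proof.
move=> rF; rewrite -cardsT -sum1_card.
rewrite [in RHS](partition_big (top F) (mem (~: F))) /=; last first.
  by move=> v _; rewrite inE top_notin.
pose oddM := big_morph odd oddD (erefl (odd 0)).
rewrite oddM [RHS]oddM; apply: eq_bigr => t _.
rewrite odd_wt -sum1_card; congr odd; apply: eq_bigl => v.
by rewrite !inE.
Qed.

End Blocks.

(** * The adversary *)

Section Adversary.
Variables (V : finType) (e : rel V) (r : V) (par : V -> V) (dep : V -> nat).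
Hypothesis rt : rooting e r par dep.
Variables (K : nat) (P : {set V} -> coloring V -> Prop).
Hypothesis P_step : forall F c x, P F c -> x \notin F -> x != r ->
  exists2 c', same_answers par F c c' & P (x |: F) c'.
Hypothesis P_stop : forall F c o, P F c -> #|F| < K ->
  ~ (forall c', same_answers par F c c' -> correct_output c' o).

(** The coloring c represents the adversary's commitments: it gives all
    answers on F. A repeated query costs the algorithm a query without enlarging
    F; a new one is answered by the coloring that the invariant provides. *)
Lemma adversary a F c : P F c -> queries_edges e a ->
  (forall c', same_answers par F c c' -> correct_output c' (run a c')) ->
  exists2 c', same_answers par F c c' & K <= #|F| + num_queries a c'.
Proof.
elim: a F c => [o|u v s IHs d IHd] F c PFc.
  move=> _ ok; exists c; first exact: same_answers_refl.
  rewrite addn0 leqNgt; apply/negP => lt; exact: (P_stop PFc lt ok).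
move=> /= /and3P [euv qs qd] ok.
have [x [xr uvx]] : exists x, x != r /\
    forall c' : coloring V, (c' u == c' v) = (c' x == c' (par x)).
  case: rt => _ eE; move: euv; rewrite eE => /orP [] /andP [xr /eqP ->].
    by exists u.
  by exists v; split => // c'; rewrite eq_sym.
(* In both cases F' contains x, so that all colorings with the same answers
   on F' as c1 give the same answer to the present query. *)
have [F' [c1 [PF' cF' xF' FF']]] : exists F' c1, [/\ P F' c1,
    (forall c', same_answers par F' c1 c' -> same_answers par F c c' /\
        (c' x == c' (par x)) = (c1 x == c1 (par x))) ,
    x \in F' & #|F'| <= #|F|.+1].
  have [xF|xF] := boolP (x \in F).
    by exists F, c; split => // c' cc'; split => //; apply: cc'.
  have [c1 cc1 P1] := P_step PFc xF xr.
  exists (x |: F), c1; split => //.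
  - move=> c' cc'; split; last by apply: cc'; rewrite setU11.
    by apply: same_answers_trans cc1 _ => w wF; apply: cc'; rewrite inE wF orbT.
  - by rewrite setU11.
  - by rewrite cardsU1 xF.
case E: (c1 x == c1 (par x)).
  have [|c' cc' Kc'] := IHs F' c1 PF' qs.
    move=> c' /cF' [/ok]; by rewrite uvx E => h1 h2; rewrite h2 in h1.
  exists c'; first by case: (cF' _ cc').
  by case: (cF' _ cc') => _; rewrite uvx E => ->; lia.
have [|c' cc' Kc'] := IHd F' c1 PF' qd.
  move=> c' /cF' [/ok]; by rewrite uvx E => h1 h2; rewrite h2 in h1.
exists c'; first by case: (cF' _ cc').
by case: (cF' _ cc') => _; rewrite uvx E => ->; lia.
Qed.

End Adversary.

(** * Merging two blocks *)

Section Merge.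
Variables (V : finType) (r : V) (par : V -> V) (dep : V -> nat).
Hypothesis dep_par : forall v, v != r -> dep v = (dep (par v)).+1.
Notation top := (top par dep).
Notation blk := (blk par dep).
Notation wt := (wt par dep).
Notation flip := (flip par dep).

Variables (F : {set V}) (x : V).
Hypotheses (rF : r \notin F) (xF : x \notin F) (xr : x != r).
Let t' := top F (par x).
Let F' := x |: F.

(** The tops of the blocks that are not affected by the query x. *)
Definition others := ~: F :\ x :\ t'.

Lemma top_par_in : t' \in ~: F :\ x.
Proof.
rewrite !inE (top_notin dep_par rF) andbT.
exact (top_par_neq dep_par rF xr).
Qed.

Lemma tops_add : ~: F' = ~: F :\ x.
Proof. by apply/setP => t; rewrite !inE negb_or. Qed.

Lemma big_tops (R : nmodType) (g : V -> R) :
  (\sum_(t in ~: F) g t = g x + (g t' + \sum_(t in others) g t))%R.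
Proof. by rewrite (big_setD1 x) ?inE //= (big_setD1 t' top_par_in). Qed.

Lemma big_tops_add (R : nmodType) (g : V -> R) :
  (\sum_(t in ~: F') g t = g t' + \sum_(t in others) g t)%R.
Proof. by rewrite tops_add (big_setD1 t' top_par_in). Qed.

Definition flip_blk (y : V) (b : bool) := flip F (fun t => (t == y) && b).

Lemma disc_flip_blk_other y b c t : y = x \/ y = t' -> t \in others ->
  disc (flip_blk y b c) (blk F' t) = disc c (blk F t).
Proof.
move=> yxt; rewrite !inE => /and3P [tt' tx tF].
rewrite (blk_add dep_par) // disc_flip.
suff -> : (t == y) && b = false by rewrite mul1r.
by case: yxt => ->; rewrite ?(negbTE tx) ?(negbTE tt').
Qed.

Lemma disc_flip_blk_merge y b c :
  disc (flip_blk y b c) (blk F' t') =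
  ((-1) ^+ ((t' == y) && b) * disc c (blk F t') +
   (-1) ^+ ((x == y) && b) * disc c (blk F x))%R.
Proof. by rewrite /disc (big_blk_merge dep_par) // -!/(disc _ _) !disc_flip. Qed.

(** Flipping the block with top x reverses the answer and changes the
    merged discrepancy from a sum to a difference. *)
Lemma merge_wt (same : bool) c : exists c1,
  [/\ same_answers par F c c1,
      forall t, t \in others -> disc c1 (blk F' t) = disc c (blk F t) &
      wt F' c1 t' = if same then wt F c t' + wt F c x
                    else `|wt F c t' - wt F c x|%N].
Proof.
have xt' : (t' == x) = false by exact (negbTE (top_par_neq dep_par rF xr)).
pose b := same (+) ((0 <= disc c (blk F t'))%R == (0 <= disc c (blk F x))%R).
exists (flip_blk x b c); split; first exact (same_answers_flip dep_par _ _ rF).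
  by move=> t tT; rewrite disc_flip_blk_other //; left.
rewrite /wt disc_flip_blk_merge xt' eqxx /= mul1r /b {b}.
move: (disc c (blk F t')) (disc c (blk F x)) => p q.
by case: same; case: (lerP 0%R p) => p0; case: (lerP 0%R q) => q0 /=; rewrite ?expr0 ?expr1 /=; lia.
Qed.

End Merge.

(** * Block weights that do not depend on the order of the queries *)

Section Canonical.
Variables (V : finType) (r : V) (par : V -> V) (dep : V -> nat).
Hypothesis dep_par : forall v, v != r -> dep v = (dep (par v)).+1.
Notation top := (top par dep).
Notation blk := (blk par dep).
Notation wt := (wt par dep).
Notation flip := (flip par dep).

(** The degree of v in the tree: its children and, for v other than the root,
    its parent. *)
Definition deg v := #|[set u | (u != r) && (par u == v)]| + (v != r).

(** The allowed weights w of a block with n vertices, degree sum d and k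
    marked vertices. Without marks w is determined by n and d; an even weight
    is congruent to 2 d modulo 4, which sums and differences of even weights
    respect, while two weights 1 can produce 0 as well as 2. With marks w is
    positive, and the factor 4 keeps all marked blocks together light. *)
Definition fits (n d k w : nat) : bool :=
  if k == 0 then w == (if odd n then 1 else (odd d).*2) else 0 < w <= 4 * k.

Definition fit (X F : {set V}) c t :=
  fits #|blk F t| (\sum_(v in blk F t) deg v) #|blk F t :&: X| (wt F c t).

Definition tame (X F : {set V}) c :=
  r \notin F /\ forall t, t \notin F -> fit X F c t.

Definition tot_wt (F : {set V}) c := \sum_(t in ~: F) wt F c t.

(** Two marked blocks have their weights added; for one marked and one
    unmarked block the weights are subtracted, unless they are equal and the
    difference would be 0. A difference is taken only if one of the weights
    belongs to an unmarked block and so is at most 2; hence the loss is at most 4. *)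
Lemma fits_merge n1 d1 k1 w1 n2 d2 k2 w2 :
  fits n1 d1 k1 w1 -> fits n2 d2 k2 w2 ->
  exists same : bool, let w := if same then w1 + w2 else `|w1 - w2|%N in
    fits (n1 + n2) (d1 + d2) (k1 + k2) w && (w1 + w2 <= w + 4).
Proof.
rewrite /fits !oddD addn_eq0.
case: (eqVneq k1 0) => [->|k10]; case: (eqVneq k2 0) => [->|k20] /=.
- move=> /eqP -> /eqP ->.
  case: (odd n1); case: (odd n2); case: (odd d1); case: (odd d2) => /=;
   by [exists true | exists false].
- move=> /eqP -> h2; exists (w2 == (if odd n1 then 1 else (odd d1).*2)).
  case: eqP => E; case: (odd n1) E; case: (odd d1) => /= E; lia.
- move=> h1 /eqP ->; exists (w1 == (if odd n2 then 1 else (odd d2).*2)).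
  case: eqP => E; case: (odd n2) E; case: (odd d2) => /= E; lia.
- by move=> h1 h2; exists true; lia.
Qed.

Lemma tame_step X F c x : tame X F c -> x \notin F -> x != r ->
  exists2 c1, same_answers par F c c1 &
    tame X (x |: F) c1 /\ tot_wt F c <= tot_wt (x |: F) c1 + 4.
Proof.
move=> [rF ok] xF xr.
have tF := top_notin dep_par rF (par x).
have [same /andP [fitw lossw]] := fits_merge (ok _ tF) (ok _ xF).
have [c1 [cc1 same_disc wt1]] := merge_wt dep_par rF xF xr same c.
exists c1 => //; split.
  split; first by rewrite root_notin_add.
  move=> t; rewrite !inE negb_or => /andP [tx tF'].
  have [->|tt'] := eqVneq t (top F (par x)).
    rewrite /fit (card_blk_merge dep_par) // (cardI_blk_merge dep_par) //.
    by rewrite (big_blk_merge dep_par) // wt1.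
  have wtt : wt (x |: F) c1 t = wt F c t.
    by rewrite /wt same_disc // !inE tx tt'.
  by rewrite /fit wtt (blk_add dep_par) //; apply: ok.
have totF : tot_wt F c = wt F c x + (wt F c (top F (par x)) +
    \sum_(t in others par dep F x) wt F c t) by exact (big_tops dep_par rF xF xr _).
have totF' : tot_wt (x |: F) c1 = wt (x |: F) c1 (top F (par x)) +
    \sum_(t in others par dep F x) wt F c t.
  rewrite [LHS](big_tops_add dep_par rF xr (R := nat)); congr (_ + _).
  by apply: eq_bigr => t tT; rewrite /wt same_disc.
by rewrite totF totF' wt1; move: lossw; lia.
Qed.

(** Singleton blocks have weight 1 in any coloring. *)
Lemma tame0 (X : {set V}) c : tame X set0 c /\ tot_wt set0 c = #|V|.
Proof.
have blk0 t : blk set0 t = [set t].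
  by apply/setP => v; rewrite !inE top_id ?inE.
have wt0 t : wt set0 c t = 1.
  by rewrite /wt /disc blk0 big_set1; case: (c t).
split; last first.
  by rewrite /tot_wt (eq_bigr (fun=> 1)) // sum1_card setC0 cardsT.
split=> [|t _]; first by rewrite inE.
by rewrite /fit /fits wt0 blk0 cards1; case: eqP => //; lia.
Qed.

(** All edges at the block are its inner edges, counted twice, and the edge
    to the parent of its top. *)
Lemma leaf_blk (F : {set V}) t : r \notin F -> t \notin F -> t != r ->
  (forall s, s \notin F -> s != r -> top F (par s) != t) ->
  (\sum_(v in blk F t) deg v).+1 = #|blk F t|.*2.
Proof.
move=> rF tF tr nochild.
have rB v : v \in blk F t -> v != r.
  by rewrite inE => /eqP vt; apply: contraNneq tr => vr; rewrite -vt vr top_id.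
have -> : \sum_(v in blk F t) deg v =
          \sum_(v in blk F t) #|[set u | (u != r) && (par u == v)]| + #|blk F t|.
  rewrite big_split /= -sum1_card; congr (_ + _).
  by apply: eq_bigr => v /rB ->.
have -> : \sum_(v in blk F t) #|[set u | (u != r) && (par u == v)]| = #|blk F t :\ t|.
  rewrite -[RHS]sum1_card [RHS](partition_big par (mem (blk F t))) /=.
    apply: eq_bigr => v vB; rewrite -sum1_card; apply: eq_bigl => u.
    rewrite !inE; case: (eqVneq (par u) v) => [uv|]; rewrite ?andbF // !andbT.
    have [uF|uF] := boolP (u \in F).
      rewrite (top_par dep_par) // uv; move: vB; rewrite inE => ->.
      rewrite andbT (mem_neq_root rF uF); apply/esym.
      by apply: contraNneq tF => <-.
    rewrite top_id // andNb; apply/negbTE/negP => ur.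
    have := nochild u uF ur; rewrite uv.
    by move: vB; rewrite inE => ->.
  move=> u; rewrite !inE => /andP [ut uB].
  have [uF|uF] := boolP (u \in F); first by rewrite -(top_par dep_par).
  by rewrite top_id // (negbTE ut) in uB.
rewrite (cardsD1 t (blk F t)) inE top_id // eqxx; lia.
Qed.

(** By [leaf_blk] a block without a block hanging below it has odd degree
    sum, which gives weight 2 if its size is even. *)
Lemma zero_blk_child X F c t : tame X F c -> t \notin F -> t != r ->
  wt F c t = 0 ->
  blk F t :&: X = set0 /\ exists s, [/\ s \notin F, s != r & top F (par s) = t].
Proof.
move=> [rF ok] tF tr wt0.
have := ok _ tF; rewrite /fit /fits wt0 ltnn /=.
case: eqP => // /eqP; rewrite cards_eq0 => /eqP -> canon0; split=> //.
have [/existsP [s /and3P [sF sr /eqP st]]|none] :=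
  boolP [exists s, [&& s \notin F, s != r & top F (par s) == t]].
  by exists s.
have E : (\sum_(v in blk F t) deg v).+1 = #|blk F t|.*2.
  apply: leaf_blk => // s sF sr; apply: contra none => st.
  by apply/existsP; exists s; apply/and3P.
move: canon0 E; case: (odd #|_|) => //.
have := odd_double_half (\sum_(v in blk F t) deg v).
case: (odd (\sum_(v in _) _)) => // h _; lia.
Qed.

End Canonical.

(** * The upper bound *)

Section AskAll.
Variables (V : finType) (e : rel V) (r : V) (par : V -> V) (dep : V -> nat).
Hypothesis rt : rooting e r par dep.

(** Asks all pairs in es and then picks a coloring that agrees with the
    answers; Q collects the answers given so far. *)
Fixpoint ask_all (es : seq (V * V)) (Q : pred (coloring V)) : algorithm V :=
  if es is (u, v) :: es' then
    Query u v (ask_all es' [pred c | Q c && (c u == c v)])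
              (ask_all es' [pred c | Q c && (c u != c v)])
  else Output (if [pick c | Q c] is Some c then [pick v | majority_vertex c v]
               else None).

Lemma num_queries_ask_all es Q c : num_queries (ask_all es Q) c = size es.
Proof. by elim: es Q => //= -[u v] es IH Q /=; rewrite !IH; case: ifP. Qed.

Lemma edges_ask_all es Q :
  all (fun uv => e uv.1 uv.2) es -> queries_edges e (ask_all es Q).
Proof. by elim: es Q => //= -[u v] es IH Q /= /andP [-> h]; rewrite !IH. Qed.

(** It does not matter which coloring is picked, if the colorings that
    agree with the answers all have the same majority vertices. *)
Lemma run_ask_all es (Q : pred (coloring V)) :
  (forall c c' : coloring V, Q c -> Q c' ->
     (forall u v, (u, v) \in es -> (c u == c v) = (c' u == c' v)) ->
     majority_vertex c =1 majority_vertex c') ->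
  forall c, Q c -> correct_output c (run (ask_all es Q) c).
Proof.
elim: es Q => [|[u v] es IH] Q maj c Qc /=.
  case: pickP => [c' Qc'|/(_ c)]; last by rewrite Qc.
  case: pickP => [v|none] /=; first by rewrite (maj _ _ Qc' Qc).
  by move=> v; rewrite (maj c c') // none.
case: ifP => cuv; apply: IH; rewrite /= ?Qc ?cuv //.
  move=> c1 c2 /andP [Q1 /eqP E1] /andP [Q2 /eqP E2] agree; apply: maj => // a b.
  by rewrite inE => /orP [/eqP [-> ->]|/agree //]; rewrite E1 E2 !eqxx.
move=> c1 c2 /andP [Q1 E1] /andP [Q2 E2] agree; apply: maj => // a b.
by rewrite inE => /orP [/eqP [-> ->]|/agree //]; rewrite (negbTE E1) (negbTE E2).
Qed.

Lemma tree_solvable : solvable_within e (#|V| - 1).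
Proof.
case: rt => dep_par eE.
pose es := [seq (v, par v) | v <- enum [set~ r]].
exists (ask_all es predT); last first.
  by move=> c; rewrite num_queries_ask_all size_map -cardE cardsC1 subn1.
split.
  apply: edges_ask_all; apply/allP => _ /mapP [v + ->].
  by rewrite mem_enum !inE /= eE eqxx => ->.
move=> c; apply: run_ask_all => // c1 c2 _ _ agree v.
(* The colorings c1 and c2 are equal or opposite. *)
have E w : c1 w (+) c2 w = c1 r (+) c2 r.
  elim/(ancestor_ind dep_par): w => w IH.
  have [-> //|wr] := eqVneq w r.
  rewrite -(IH wr); have := agree w (par w).
  rewrite map_f ?mem_enum ?inE // => /(_ isT).
  by case: (c1 w); case: (c1 (par w)); case: (c2 w); case: (c2 (par w)).
congr (_ < 2 * _); apply: eq_card => w; rewrite !inE.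
have := E w; rewrite -(E v).
by case: (c1 w); case: (c1 v); case: (c2 w); case: (c2 v).
Qed.

End AskAll.

Lemma odd_half_absD (x y : int) : ~~ odd `|x|%N -> ~~ odd `|y|%N ->
  odd (`|(x + y)%R|%N./2) = odd (`|x|%N./2) (+) odd (`|y|%N./2).
Proof. lia. Qed.

(** As s has the sign of d, the third hypothesis says that |d| <= |s| <= 2, and
    |d| is even and positive. *)
Lemma min_toggle (d s : int) : (0 < d * s)%R -> ~~ odd `|d|%N ->
  `|d|%N <= `|(d - s *+ 2)%R|%N -> `|s|%N <= 2 -> `|d|%N = 2 /\ d = s.
Proof.
case: (ltgtP d 0%R) => [d0|d0|->]; last by rewrite mul0r ltxx.
  by rewrite nmulr_rgt0 //; move: d0; lia.
by rewrite pmulr_rgt0 //; move: d0; lia.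
Qed.

(** If d = s, then toggling q, or q and s, gives d - 2 q or - d - 2 q, one of which
    is 0 if d = 2 and q = 1 up to sign. *)
Lemma toggle_to_zero (d s q : int) : `|q|%N = 1 -> `|d|%N = 2 -> d = s ->
  `|d|%N <= `|(d - s *+ 2 - q *+ 2)%R|%N -> `|d|%N <= `|(d - q *+ 2)%R|%N -> False.
Proof. lia. Qed.

(** * Even order: all edges must be queried *)

Section EvenStop.
Variables (V : finType) (r : V) (par : V -> V) (dep : V -> nat).
Hypothesis dep_par : forall v, v != r -> dep v = (dep (par v)).+1.
Notation top := (top par dep).
Notation blk := (blk par dep).
Notation wt := (wt par dep).
Notation flip := (flip par dep).

Implicit Types (F : {set V}) (c : coloring V).

Lemma disc_neq0_majority (c : coloring V) :
  disc c setT <> 0%R -> exists v, majority_vertex c v.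
Proof.
move=> D0; have [/existsP //|none] := boolP [exists v, majority_vertex c v].
have : (disc c setT * disc c setT <= 0)%R.
  rewrite {1}/disc mulr_suml; apply: sumr_le0 => v _.
  rewrite leNgt -majority_disc; apply: contra none => h; by apply/existsP; exists v.
by move: (disc c setT) D0 => D; nia.
Qed.

Lemma disc_flip_setT F (eps : pred V) c : r \notin F ->
  (disc (flip F eps c) setT = \sum_(t in ~: F) (-1) ^+ eps t * disc c (blk F t))%R.
Proof.
move=> rF; rewrite (disc_setT dep_par _ rF); apply: eq_bigr => t _.
by rewrite disc_flip.
Qed.

(** Making all blocks agree gives the largest discrepancy. *)
Lemma disc_flip_pos F c : r \notin F ->
  disc (flip F (fun t => (disc c (blk F t) < 0)%R) c) setT = (tot_wt par dep F c)%:Z%R.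
Proof.
move=> rF; rewrite disc_flip_setT // /tot_wt (big_morph Posz PoszD (erefl (Posz 0))).
apply: eq_bigr => t _; rewrite /wt; case: (ltP (disc c (blk F t)) 0%R) => h.
  by rewrite expr1; lia.
by rewrite expr0; lia.
Qed.

(** Take signs with least absolute total D and suppose that D is not 0.
    Toggling a block whose sign agrees with D cannot help, so its weight is at
    least |D|, which forces D to be plus or minus 2; a block of weight 1 could
    then be used to reach 0. So all blocks have even size, and the number of blocks
    of weight 2 is odd as D is 2 modulo 4. This number has the parity of
    the sum of all degrees, which is twice the number of edges. *)
Lemma balanced_flip F c : tame r par dep set0 F c -> ~~ odd #|V| ->
  exists eps : pred V, disc (flip F eps c) setT = 0%R.
Proof.
move=> [rF ok] evenV.
pose a (B : {set V}) t : int := ((-1) ^+ (t \in B) * disc c (blk F t))%R.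
pose D B : int := (\sum_(t in ~: F) a B t)%R.
have DE (B : {set V}) : disc (flip F (fun t => t \in B) c) setT = D B by rewrite disc_flip_setT.
(* B is the set of flipped blocks, a B t the signed discrepancy of block t, and
   tog B t toggles one block. *)
pose tog (B : {set V}) t := [set u | (u \in B) (+) (u == t)].
have a_tog B t u : a (tog B t) u = if u == t then (- a B u)%R else a B u.
  by rewrite /a inE; case: (u == t); case: (u \in B); rewrite /= ?expr0 ?expr1 ?mul1r ?mulN1r ?opprK.
have D_tog B t : t \notin F -> D (tog B t) = (D B - a B t *+ 2)%R.
  move=> tF; rewrite /D (bigD1 t) ?inE //= [in RHS](bigD1 t) ?inE //= a_tog eqxx.
  rewrite (eq_bigr (a B)); first by rewrite mulr2n; move: (a B t) (\sum_(u in _ | _) _)%R; clear; lia.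
  by move=> u /andP [_ ut]; rewrite a_tog (negbTE ut).
have absa B t : `|a B t|%N = wt F c t.
  by rewrite /a /wt; case: (t \in B); rewrite ?expr0 ?expr1 ?mul1r ?mulN1r ?abszN.
have wt_even t : t \notin F -> ~~ odd #|blk F t| ->
    wt F c t = (odd (\sum_(v in blk F t) deg r par v)).*2.
  move=> tF ev; have := ok _ tF.
  by rewrite /fit /fits setI0 cards0 eqxx (negbTE ev) => /eqP.
have wt_odd t : t \notin F -> odd #|blk F t| -> wt F c t = 1.
  by move=> tF od; have := ok _ tF; rewrite /fit /fits setI0 cards0 eqxx od => /eqP.
have wt2 t : t \notin F -> wt F c t <= 2.
  move=> tF; have [od|ev] := boolP (odd #|blk F t|); first by rewrite wt_odd.
  by rewrite wt_even //; case: (odd _).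
case: (@arg_minnP _ (set0 : {set V}) xpredT (fun B => `|D B|%N) isT) => B _ minB.
exists (fun t => t \in B); rewrite DE.
have minD t : t \notin F -> `|D B|%N <= `|(D B - a B t *+ 2)%R|%N.
  by move=> tF; rewrite -D_tog // minB.
have minD2 t u : t \notin F -> u \notin F -> u != t ->
    `|D B|%N <= `|(D B - a B t *+ 2 - a B u *+ 2)%R|%N.
  move=> tF uF ut; have := minB (tog (tog B t) u) isT.
  by rewrite D_tog // D_tog // a_tog (negbTE ut).
apply/eqP; apply: contraT => D0.
have evenD : odd `|D B|%N = odd #|V|.
  rewrite -(odd_sum_wt dep_par c rF) (big_morph odd oddD (erefl (odd 0))).
  rewrite /D (big_morph (fun x : int => odd `|x|%N) odd_absD (erefl (odd `|(0%R : int)|%N))).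
  by apply: eq_bigr => t _; rewrite absa.
rewrite (negbTE evenV) in evenD.
have [t /andP [tF tpos]] : exists t, (t \notin F) && (0 < D B * a B t)%R.
  apply/existsP; apply: contraT; rewrite negb_exists => /forallP none.
  have : (D B * D B <= 0)%R.
    rewrite {2}/D mulr_sumr; apply: sumr_le0 => t; rewrite inE => tF.
    by have := none t; rewrite tF /= leNgt.
  by rewrite leNgt -expr2 exprn_even_gt0 ?D0 //.
have two : `|D B|%N = 2 /\ D B = a B t.
  by apply: min_toggle (minD t tF) _ => //; rewrite ?evenD // absa wt2.
(* Toggling t turns D into - D; toggling u alone, or t and u, would give 0
   if u had weight 1. *)
have noone u : u \notin F -> ~~ odd #|blk F u|.
  move=> uF; apply/negP => od; have w1 := wt_odd _ uF od.
  have ut : u != t.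
    apply: contraPneq two => ut; rewrite -ut => -[E1 E2].
    by move: E1; rewrite E2 absa w1.
  case: two => D2 Dt; apply: toggle_to_zero (minD2 t u tF uF ut) (minD u uF) => //.
  by rewrite absa.
have : odd (\sum_(u in ~: F) \sum_(v in blk F u) deg r par v).
  have [_ ->] : ~~ odd `|D B|%N /\
     odd (\sum_(u in ~: F) \sum_(v in blk F u) deg r par v) = odd (`|D B|%N./2).
    (* Halving is additive on even numbers up to parity, so the parity of D / 2 is the
       parity of the number of blocks of weight 2. *)
    rewrite /D; elim/big_ind2: _ => // [x1 x2 y1 y2 [e1 h1] [e2 h2]|u].
      by rewrite oddD odd_half_absD // h1 h2 odd_absD (negbTE e1) (negbTE e2).
    rewrite inE absa => uF; rewrite wt_even ?noone //.
    by rewrite odd_double doubleK oddb.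
  by case: two => -> _.
have -> : \sum_(u in ~: F) \sum_(v in blk F u) deg r par v = (#|V| - 1).*2.
  have -> : \sum_(u in ~: F) \sum_(v in blk F u) deg r par v = \sum_(v : V) deg r par v.
    rewrite [RHS](partition_big (top F) (mem (~: F))) /=; last first.
      by move=> v _; rewrite inE (top_notin dep_par).
    by apply: eq_bigr => u _; apply: eq_bigl => v; rewrite inE.
  have cr : #|[set~ r]| = #|V| - 1 by rewrite cardsC1 subn1.
  rewrite big_split /= -addnn -cr; congr (_ + _).
    rewrite -[RHS]sum1_card [RHS](partition_big par predT) //=.
    apply: eq_bigr => v _; rewrite -sum1_card; apply: eq_bigl => u.
    by rewrite !inE.
  by rewrite -sum1_card [RHS]big_mkcond; apply: eq_bigr => v _; rewrite !inE; case: eqP.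
by rewrite odd_double.
Qed.

(** Against an output vertex the blocks are balanced. Against the output that
    there is no majority, all blocks are made to agree: the deepest top other
    than the root has no block below it, hence positive weight. *)
Lemma even_stop F c o : tame r par dep set0 F c -> ~~ odd #|V| -> #|F| < #|V| - 1 ->
  ~ (forall c', same_answers par F c c' -> correct_output c' o).
Proof.
move=> tm evenV ltF ok; have rF := tm.1.
case: o ok => [v|] ok.
  have [eps D0] := balanced_flip tm evenV.
  have := ok _ (same_answers_flip dep_par eps c rF).
  by rewrite /= majority_disc D0 mulr0.
have /existsP [t0 /andP [t0F t0r]] : [exists t, (t \notin F) && (t != r)].
  apply: contraT; rewrite negb_exists => /forallP none.
  suff : #|V| - 1 <= #|F| by rewrite leqNgt ltF.
  have <- : #|[set~ r]| = #|V| - 1 by rewrite cardsC1 subn1.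
  apply: subset_leq_card; apply/subsetP => t; rewrite !inE => tr.
  by have := none t; rewrite tr andbT negbK.
have t0P : (t0 \notin F) && (t0 != r) by rewrite t0F.
case: (@arg_maxnP _ t0 (fun t => (t \notin F) && (t != r)) dep t0P).
move=> t /andP [tF tr] maxt.
have wt0 : 0 < wt F c t.
  rewrite lt0n; apply/eqP => /(zero_blk_child dep_par tm tF tr) [_ [s [sF sr st]]].
  have := maxt s; rewrite sF sr => /(_ isT); rewrite (dep_par sr) -st.
  by have := dep_top dep_par rF (par s); lia.
have [|v] := @disc_neq0_majority (flip F (fun t => (disc c (blk F t) < 0)%R) c).
  rewrite disc_flip_pos // /tot_wt (bigD1 t) ?inE //=; lia.
by apply/negP; exact (ok _ (same_answers_flip dep_par _ c rF) v).
Qed.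

End EvenStop.

Lemma even_tree_lower (V : finType) (e : rel V) a :
  is_tree e -> ~~ odd #|V| -> solves_majority e a ->
  exists c, #|V| - 1 <= num_queries a c.
Proof.
move=> /tree_rooting [r [par [dep rt]]] evenV [qa ok].
have [dep_par _] := rt.
have step F c x : tame r par dep set0 F c -> x \notin F -> x != r ->
    exists2 c', same_answers par F c c' & tame r par dep set0 (x |: F) c'.
  by move=> tm xF xr; have [c1 cc1 []] := tame_step dep_par tm xF xr; exists c1.
have stop F c o : tame r par dep set0 F c -> #|F| < #|V| - 1 ->
    ~ (forall c', same_answers par F c c' -> correct_output c' o).
  by move=> tm ltF; apply: even_stop tm evenV ltF.
have [tm0 _] := tame0 r par dep set0 [ffun=> true].
have [c _] := adversary rt step stop tm0 qa (fun c' _ => ok c').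
by rewrite cards0; exists c.
Qed.

(** * The parity of the number of negative sign patterns *)

Section NegParity.

(** The parity of the number of sign choices for the positive weights in ws
    with negative sum, starting from s. Zero weights carry no sign: otherwise a
    single one would make every parity even. *)
Fixpoint negpar (s : int) (ws : seq nat) : bool :=
  if ws is w :: ws' then
    if w == 0 then negpar s ws'
    else negpar (s + w%:Z)%R ws' (+) negpar (s - w%:Z)%R ws'
  else (s < 0)%R.

Lemma negpar_swap s a b ws : negpar s (a :: b :: ws) = negpar s (b :: a :: ws).
Proof.
rewrite /=; case: (a == 0); case: (b == 0) => //.
have -> : (s - b%:Z + a%:Z = s + a%:Z - b%:Z)%R by lia.
have -> : (s + b%:Z + a%:Z = s + a%:Z + b%:Z)%R by lia.
have -> : (s + b%:Z - a%:Z = s - a%:Z + b%:Z)%R by lia.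
have -> : (s - b%:Z - a%:Z = s - a%:Z - b%:Z)%R by lia.
by rewrite addbACA.
Qed.

Lemma eq_negpar_cons a ws ws' : (forall s, negpar s ws = negpar s ws') ->
  forall s, negpar s (a :: ws) = negpar s (a :: ws').
Proof. by move=> E s /=; rewrite !E. Qed.

Lemma negpar_rem a ws : a \in ws -> forall s, negpar s ws = negpar s (a :: rem a ws).
Proof.
elim: ws => // b ws IH; rewrite inE => ain s; rewrite [rem a _]/=.
have [-> //|ba] := eqVneq b a.
have aws : a \in ws by move: ain; rewrite eq_sym (negbTE ba).
by rewrite (eq_negpar_cons _ (IH aws)) negpar_swap.
Qed.

Lemma negpar_perm s ws ws' : perm_eq ws ws' -> negpar s ws = negpar s ws'.
Proof.
elim: ws ws' s => [|a ws IH] ws' s p.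
  by move: p; rewrite perm_sym => /perm_nilP ->.
have ain : a \in ws' by rewrite -(perm_mem p) mem_head.
rewrite (negpar_rem ain); apply: eq_negpar_cons => s'; apply: IH.
by rewrite -(perm_cons a); apply: perm_trans p _; apply: perm_to_rem.
Qed.

(** Sign patterns that give a and b the same sign are those of a + b, the
    others are those of |a - b|; if a = b, the latter occur in pairs with the same
    sum. *)
Lemma negpar_merge s a b ws : 0 < a -> 0 < b ->
  negpar s (a :: b :: ws) =
  negpar s (a + b :: ws) (+) ((a != b) && negpar s (`|a - b|%N :: ws)).
Proof.
move=> a0 b0 /=.
have -> : (a == 0) = false by lia.
have -> : (b == 0) = false by lia.
have -> : (a + b == 0) = false by lia.
have -> : (s + (a + b)%:Z = s + a%:Z + b%:Z)%R by lia.
have -> : (s - (a + b)%:Z = s - a%:Z - b%:Z)%R by lia.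
have [<-|ab] /= := eqVneq a b.
  rewrite (_ : s + a%:Z - a%:Z = s - a%:Z + a%:Z)%R; last by lia.
  by case: (negpar _ _); case: (negpar _ _); case: (negpar _ _).
have -> : (`|a - b| == 0)%N = false by lia.
case: (ltnP a b) => lt.
  have -> : (s + `|a - b|%N%:Z = s - a%:Z + b%:Z)%R by lia.
  have -> : (s - `|a - b|%N%:Z = s + a%:Z - b%:Z)%R by lia.
  by case: (negpar _ _); case: (negpar _ _); case: (negpar _ _); case: (negpar _ _).
have -> : (s + `|a - b|%N%:Z = s + a%:Z - b%:Z)%R by lia.
have -> : (s - `|a - b|%N%:Z = s - a%:Z + b%:Z)%R by lia.
by case: (negpar _ _); case: (negpar _ _); case: (negpar _ _); case: (negpar _ _).
Qed.

Lemma negpar_double s w ws : negpar s (w :: w :: ws) = negpar s (w.*2 :: ws).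
Proof.
have [-> //|w0] := posnP w.
by rewrite negpar_merge // eqxx addbF addnn.
Qed.

(** Iterates [negpar_double]: as a polynomial identity modulo 2,
    (z + 1/z)^(2^j) = z^(2^j) + 1/z^(2^j). *)
Lemma negpar_pow j w ws s :
  negpar s (nseq (2 ^ j) w ++ ws) = negpar s (2 ^ j * w :: ws).
Proof.
elim: j w ws s => [|j IH] w ws s; first by rewrite mul1n.
rewrite expnS mul2n -addnn nseqD -catA IH.
rewrite (eq_negpar_cons _ (IH w ws)) negpar_double.
by rewrite -addnn -mulnDl.
Qed.

Lemma negpar_pairs j w ws s :
  negpar s (nseq j.*2 w ++ ws) = negpar s (nseq j w.*2 ++ ws).
Proof.
elim: j s => // j IH s; rewrite doubleS.
change (negpar s [:: w, w & nseq j.*2 w ++ ws] =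
        negpar s (w.*2 :: nseq j w.*2 ++ ws)).
by rewrite negpar_double; apply: eq_negpar_cons.
Qed.

Lemma negpar_ge s ws : ((sumn ws)%:Z <= s)%R -> negpar s ws = false.
Proof.
elim: ws s => [|w ws IH] s /= h; first by lia.
by case: ifP => _; rewrite !IH //; lia.
Qed.

Lemma negpar_lt s ws : (s + (sumn ws)%:Z < 0)%R -> negpar s ws = ~~ has (leq 1) ws.
Proof.
elim: ws s => [|w ws IH] s /= h; first by lia.
have [w0|w0] := posnP w; first by rewrite IH //; lia.
by rewrite !IH ?addbb //; lia.
Qed.

(** The pattern with all signs positive is the only one whose sum is not
    negative, so the number of negative patterns is a power of 2 minus 1, which is odd
    unless there is no positive weight at all. *)
Lemma negpar_all_but_one s ws :
  (0 <= s + (sumn ws)%:Z)%R ->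
  (forall w, w \in ws -> 0 < w -> (s + (sumn ws)%:Z < (w.*2)%:Z)%R) ->
  negpar s ws = has (leq 1) ws.
Proof.
elim: ws s => [|w ws IH] s /= h lt; first by lia.
have ltw u : u \in ws -> 0 < u -> (s + w%:Z + (sumn ws)%:Z < (u.*2)%:Z)%R.
  by move=> uws u0; have := lt u; rewrite inE uws orbT => /(_ isT u0); lia.
have [w0|w0] := posnP w.
  rewrite IH //; first by lia.
  by move=> u uws u0; have := ltw u uws u0; lia.
rewrite IH //; last by lia.
rewrite negpar_lt; last by have := lt w (mem_head _ _) w0; lia.
by case: (has _ _).
Qed.

Lemma perm_nseq_filter (w : nat) ws :
  perm_eq ws (nseq (count_mem w ws) w ++ filter (predC1 w) ws).
Proof.
have <- : filter (pred1 w) ws = nseq (count_mem w ws) w.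
  rewrite -size_filter; apply/all_pred1P.
  by rewrite filter_all.
by rewrite perm_sym; apply/permPl; apply: perm_filterC.
Qed.

Lemma sumn_perm (ws ws' : seq nat) : perm_eq ws ws' -> sumn ws = sumn ws'.
Proof. by move=> p; rewrite !sumnE; apply: perm_big. Qed.

(** Modulo 2, trade the ones for half as many twos and 2^k twos for a single
    weight W = 2^(k+1). With W positive no pattern is negative; with W negative
    the largest sum is the total minus 2^(k+2), which is 1 or 3, and every remaining
    positive weight is at least 2, so that [negpar_all_but_one] applies. *)
Lemma negpar_start k (s : nat) ws :
  ~~ odd (count_mem 1 ws) -> 2 ^ k <= (count_mem 1 ws)./2 + count_mem 2 ws ->
  1 < s <= 2 ^ k.+1 -> (2 ^ k.+2 < s + sumn ws <= 2 ^ k.+2 + 3) ->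
  odd (s + sumn ws) ->
  negpar s%:Z ws.
Proof.
move=> ev big s2 sum oddsum.
have p1 := perm_nseq_filter 1 ws.
set l := filter (predC1 1) ws in p1.
have p2 := perm_nseq_filter 2 l.
set l2 := filter (predC1 2) l in p2.
have c2 : count_mem 2 l = count_mem 2 ws.
  by rewrite count_filter; apply: eq_count => w /=; case: eqP => // ->.
rewrite c2 in p2.
set j := (count_mem 1 ws)./2 in big; set b := count_mem 2 ws in big p2.
have jE : count_mem 1 ws = j.*2 by rewrite /j halfK (negbTE ev) subn0.
rewrite jE in p1.
have p : perm_eq ws (nseq j.*2 1 ++ (nseq b 2 ++ l2)).
  by apply: perm_trans p1 _; rewrite perm_cat2l.
rewrite (negpar_perm _ p) negpar_pairs.
have -> : nseq j 1.*2 ++ nseq b 2 ++ l2 =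
          nseq (2 ^ k) 2 ++ (nseq (j + b - 2 ^ k) 2 ++ l2).
  by rewrite !catA -!nseqD subnKC.
rewrite negpar_pow -expnSr.
set rest := nseq _ 2 ++ l2.
have sumr : sumn ws = 2 ^ k.+1 + sumn rest.
  rewrite (sumn_perm p) !sumn_cat !sumn_nseq mul1n -muln2 expnS; lia.
have rest2 w : w \in rest -> 0 < w -> 1 < w.
  rewrite mem_cat mem_nseq => /orP [/andP [_ /eqP -> //]|].
  by rewrite !mem_filter /= => /and3P [_ w1 _]; lia.
have K4 : 2 ^ k.+2 = 2 ^ k.+1 + 2 ^ k.+1 by rewrite addnn -mul2n -expnS.
have K0 : 0 < 2 ^ k.+1 by rewrite expn_gt0.
rewrite /= (_ : (2 ^ k.+1 == 0) = false); last by lia.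
rewrite negpar_ge; last by lia.
rewrite addFb negpar_all_but_one.
- apply/hasP; apply/hasP; apply: contraT => /hasPn none.
  suff : sumn rest = 0 by lia.
  rewrite sumnE big_seq big1 // => w /none; lia.
- lia.
- move=> w wr /(rest2 _ wr) w2; lia.
Qed.

Section Patterns.
Variables (T : eqType) (f : T -> nat).

Definition signed_sum (eps : pred T) (ts : seq T) : int :=
  (\sum_(t <- ts) (-1) ^+ eps t * (f t)%:Z)%R.

(** All or none of an even number of patterns are negative. *)
Lemma negpar_const (b : bool) ts s : uniq ts ->
  (forall eps, (s + signed_sum eps ts < 0)%R = b) ->
  has (fun t => 0 < f t) ts -> negpar s [seq f t | t <- ts] = false.
Proof.
suff H : uniq ts -> (forall eps, (s + signed_sum eps ts < 0)%R = b) ->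
    negpar s [seq f t | t <- ts] = b && ~~ has (fun t => 0 < f t) ts.
  by move=> u c h; rewrite H // h andbF.
elim: ts s => [|t ts IH] s /=.
  by move=> _ /(_ xpred0); rewrite /signed_sum big_nil addr0 andbT.
move=> /andP [tts uts] const.
have ext (d : bool) (eps : pred T) : (s + (-1) ^+ d * (f t)%:Z + signed_sum eps ts < 0)%R = b.
  rewrite -(const (fun u => if u == t then d else eps u)) /signed_sum big_cons eqxx.
  rewrite addrA; congr (_ + _ < 0)%R; apply: eq_big_seq => u uts'.
  by rewrite ifN //; apply: contraNneq tts => <-.
case: posnP => ft0.
  by apply: IH => // eps; rewrite -(ext false eps) ft0 mulr0 addr0.
rewrite (IH (s + _)%R) //; last by move=> eps; rewrite -(ext false eps) expr0 mul1r.
rewrite (IH (s - _)%R) //; last by move=> eps; rewrite -(ext true eps) expr1 mulN1r.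
by rewrite addbb andbF.
Qed.

(** For each sign of the weight of t there is an even number of patterns,
    and all or none of them are negative. *)
Lemma negpar_const_at (b : bool -> bool) t ts s : uniq (t :: ts) -> 0 < f t ->
  (forall eps, (s + signed_sum eps (t :: ts) < 0)%R = b (eps t)) ->
  has (fun t => 0 < f t) ts -> negpar s [seq f t | t <- t :: ts] = false.
Proof.
move=> /= /andP [tts uts] ft0 const hasp.
have ext (d : bool) (eps : pred T) : (s + (-1) ^+ d * (f t)%:Z + signed_sum eps ts < 0)%R = b d.
  have := const (fun u => if u == t then d else eps u); rewrite eqxx => <-.
  rewrite /signed_sum big_cons eqxx addrA; congr (_ + _ < 0)%R.
  apply: eq_big_seq => u uts'.
  by rewrite ifN //; apply: contraNneq tts => <-.
rewrite (negbTE (lt0n_neq0 ft0)).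
rewrite (@negpar_const (b false)) //; last first.
  by move=> eps; rewrite -(ext false eps) expr0 mul1r.
rewrite (@negpar_const (b true)) // => eps.
by rewrite -(ext true eps) expr1 mulN1r.
Qed.

End Patterns.
End NegParity.

(** * The parity phase *)

Section ParityPhase.

Lemma signed_abs (x : int) : ((-1) ^+ (x < 0)%R * x = `|x|%N%:Z)%R.
Proof. by case: ltP => h; rewrite ?expr0 ?expr1; lia. Qed.

Lemma signed_absN (x : int) : ((-1) ^+ (~~ (x < 0)%R) * x = - `|x|%N%:Z)%R.
Proof. by case: ltP => h; rewrite ?expr0 ?expr1; lia. Qed.

Variables (V : finType) (r : V) (par : V -> V) (dep : V -> nat).
Hypothesis dep_par : forall v, v != r -> dep v = (dep (par v)).+1.
Notation top := (top par dep).
Notation blk := (blk par dep).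
Notation wt := (wt par dep).
Notation flip := (flip par dep).

Lemma wt0_disc (F : {set V}) c t : wt F c t = 0 -> disc c (blk F t) = 0%R.
Proof. by move/eqP; rewrite absz_eq0 => /eqP. Qed.

Implicit Types (F Rs Z : {set V}) (c : coloring V).

(** The reference blocks are those containing a vertex of Rs; their number never
    grows. *)
Definition refs Rs F := [set top F u | u in Rs].
Definition free_wt Rs F c t := if t \in refs Rs F then 0 else wt F c t.
Definition ref_disc Rs F c t : int :=
  if t \in refs Rs F then disc c (blk F t) else 0%R.
(** The discrepancies of the reference blocks enter with their signs, the
    other blocks only with their weights, that is, up to flips. *)
Definition undecided Rs F c :=
  negpar (\sum_(t in ~: F) ref_disc Rs F c t)%R
         [seq free_wt Rs F c t | t <- enum (~: F)].

(** Z collects the vertices in blocks of weight 0 at the start of the phase;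
    the last clause says that no such block has been created since. *)
Definition parity_state Rs Z F c :=
  [/\ r \notin F, undecided Rs F c &
      forall t, t \notin F -> t \notin refs Rs F -> wt F c t = 0 ->
        blk F t \subset Z].

Lemma refs_add Rs F x t : r \notin F -> x \notin F -> x != r ->
  t \in ~: F :\ x ->
  (t \in refs Rs (x |: F)) =
  (t \in refs Rs F) || ((t == top F (par x)) && (x \in refs Rs F)).
Proof.
move=> rF xF xr; rewrite !inE => /andP [tx tF].
apply/imsetP/orP => [[u uR ->]|[/imsetP [u uR tu]|/andP [/eqP tt' /imsetP [u uR xu]]]].
- rewrite (top_add dep_par) //; case: eqP => [ux|_].
    by right; rewrite eqxx /=; apply/imsetP; exists u.
  by left; apply/imsetP; exists u.
- by exists u => //; rewrite (top_add dep_par) // -tu (negbTE tx).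
- by exists u => //; rewrite (top_add dep_par) // -xu eqxx.
Qed.

Lemma perm_tops F x : r \notin F -> x \notin F -> x != r ->
  perm_eq (enum (~: F)) (x :: top F (par x) :: enum (others par dep F x)) /\
  perm_eq (enum (~: (x |: F))) (top F (par x) :: enum (others par dep F x)).
Proof.
move=> rF xF xr; have t'x := top_par_neq dep_par rF xr.
have t'F := top_notin dep_par rF (par x).
have u1 : uniq (top F (par x) :: enum (others par dep F x)).
  by rewrite /= enum_uniq mem_enum !inE eqxx.
split; apply: uniq_perm; rewrite ?enum_uniq //.
- by rewrite cons_uniq u1 inE mem_enum !inE eq_sym (negbTE t'x) eqxx /= ?andbF.
- move=> t; rewrite !(inE, mem_enum); case: (eqVneq t x) => [->|] //=.
  by case: (eqVneq t (top F (par x))) => [->|].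
- move=> t; rewrite !(inE, mem_enum) negb_or.
  by case: (eqVneq t (top F (par x))) => [->|]; rewrite ?t'x.
Qed.

(** Merging into a reference block fixes the sign of the other block, and one
    of the two signs leaves an odd number of negative patterns. Two other blocks are
    merged by [negpar_merge]; equal weights are added. *)
Lemma parity_step Rs Z F c x : parity_state Rs Z F c -> x \notin F -> x != r ->
  exists2 c1, same_answers par F c c1 & parity_state Rs Z (x |: F) c1.
Proof.
move=> [rF und zero] xF xr.
set t' := top F (par x).
have t'F : t' \notin F := top_notin dep_par rF (par x).
have t'x : t' != x := top_par_neq dep_par rF xr.
have rF' : r \notin x |: F by apply: root_notin_add.
have [perm1 perm2] := perm_tops rF xF xr.
have refsO t : t \in others par dep F x -> (t \in refs Rs (x |: F)) = (t \in refs Rs F).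
  rewrite in_setD1 => /andP [tt' tx]; rewrite refs_add //.
  by rewrite (negbTE tt') andFb orbF.
have refst' : (t' \in refs Rs (x |: F)) = (t' \in refs Rs F) || (x \in refs Rs F).
  by rewrite refs_add // ?eqxx // !inE t'x.
(* l and s are the contributions of the blocks that the query does not affect. *)
pose l := [seq free_wt Rs F c t | t <- enum (others par dep F x)].
pose s := (\sum_(t in others par dep F x) ref_disc Rs F c t)%R.
have und0 : negpar (ref_disc Rs F c x + (ref_disc Rs F c t' + s))%R
                   (free_wt Rs F c x :: free_wt Rs F c t' :: l).
  move: und; rewrite /undecided (big_tops dep_par rF xF xr).
  by rewrite (negpar_perm _ (perm_map _ perm1)).
suff [c1 [cc1 same_disc und1 zero1]] : exists c1,
  [/\ same_answers par F c c1,
      forall t, t \in others par dep F x -> disc c1 (blk (x |: F) t) = disc c (blk F t),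
      negpar (ref_disc Rs (x |: F) c1 t' + s)%R (free_wt Rs (x |: F) c1 t' :: l) &
      t' \notin refs Rs (x |: F) -> wt (x |: F) c1 t' = 0 ->
        wt F c t' = 0 /\ wt F c x = 0].
  exists c1 => //; split => //.
    rewrite /undecided (big_tops_add dep_par rF xr) (negpar_perm _ (perm_map _ perm2)).
    rewrite /= -/t'.
    have -> : [seq free_wt Rs (x |: F) c1 t | t <- enum (others par dep F x)] = l.
      apply/eq_in_map => t; rewrite mem_enum => tO.
      by rewrite /free_wt /wt refsO // same_disc.
    rewrite (eq_bigr (ref_disc Rs F c)) // => t tO.
    by rewrite /ref_disc refsO // same_disc.
  move=> t tF' tR wt0.
  have [tt'|tt'] := eqVneq t t'.
    subst t; have [w1 w2] := zero1 tR wt0.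
    move: tR; rewrite refst' negb_or => /andP [t'R xR].
    have /subsetP s1 := zero t' t'F t'R w1; have /subsetP s2 := zero x xF xR w2.
    apply/subsetP => v; rewrite inE (top_add dep_par) //.
    case: ifP => [vx _|_ vt]; first by apply: s2; rewrite inE.
    by apply: s1; rewrite inE.
  have tO : t \in others par dep F x.
    by move: tF'; rewrite !inE negb_or => /andP [-> ->]; rewrite tt'.
  have tx : t != x by move: tO; rewrite !inE => /and3P [].
  rewrite (blk_add dep_par) //; apply: zero; first by move: tO; rewrite !inE => /and3P [].
    by rewrite -refsO.
  by move: wt0; rewrite /wt same_disc.
rewrite /ref_disc /free_wt refst'; move: und0; rewrite /ref_disc /free_wt.
case t'R: (t' \in refs Rs F); case xR: (x \in refs Rs F).
(* Two reference blocks: keep the coloring. *)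
- rewrite /= => und1; exists (flip_blk par dep F x false c); split.
  + exact (same_answers_flip dep_par _ _ rF).
  + by move=> t tO; rewrite (disc_flip_blk_other dep_par) //; left.
  + rewrite (disc_flip_blk_merge dep_par) // !andbF !mul1r -/t'.
    by move: und1; rewrite addrCA addrA.
  + by [].
- rewrite /= add0r => und1.
  have [b hb] : exists b : bool,
     negpar (disc c (blk F t') + (-1) ^+ b * disc c (blk F x) + s)%R l.
    move: und1; case: eqP => [/wt0_disc w0|_].
      by exists false; rewrite w0 mulr0 addr0.
    case H: (negpar (_ + _) l) => /= H'.
      by exists (disc c (blk F x) < 0)%R; rewrite signed_abs addrAC.
    by exists (~~ (disc c (blk F x) < 0)%R); rewrite signed_absN addrAC.
  exists (flip_blk par dep F x b c); split.
  + exact (same_answers_flip dep_par _ _ rF).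
  + by move=> t tO; rewrite (disc_flip_blk_other dep_par) //; left.
  + by rewrite (disc_flip_blk_merge dep_par) // -/t' eqxx (negbTE t'x) mul1r.
  + by [].
- rewrite /= add0r => und1.
  have [b hb] : exists b : bool,
     negpar ((-1) ^+ b * disc c (blk F t') + disc c (blk F x) + s)%R l.
    move: und1; case: eqP => [/wt0_disc w0|_].
      by exists false; rewrite w0 mulr0 add0r.
    case H: (negpar (_ + _) l) => /= H'.
      by exists (disc c (blk F t') < 0)%R; rewrite signed_abs -addrA addrC.
    by exists (~~ (disc c (blk F t') < 0)%R); rewrite signed_absN -addrA addrC.
  exists (flip_blk par dep F t' b c); split.
  + exact (same_answers_flip dep_par _ _ rF).
  + by move=> t tO; rewrite (disc_flip_blk_other dep_par) //; right.
  + by rewrite (disc_flip_blk_merge dep_par) // -/t' eqxx eq_sym (negbTE t'x) mul1r.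
  + by [].
(* No reference block: a zero weight merges freely, otherwise the merged
   weight stays positive. *)
- move=> und1; have {}und1 : negpar s (wt F c x :: wt F c t' :: l).
    by rewrite -[s]add0r -[X in negpar X _]add0r.
  have [same hs] : exists same : bool,
      let w := if same then wt F c t' + wt F c x else `|wt F c t' - wt F c x|%N in
      negpar s (w :: l) /\ (w = 0 -> wt F c t' = 0 /\ wt F c x = 0).
    have [x0|x0] := posnP (wt F c x).
      by exists true; rewrite x0 addn0; split=> //; rewrite x0 in und1.
    have [t0|t0] := posnP (wt F c t').
      exists true; rewrite t0 add0n; split=> //.
      by move: und1; rewrite t0 negpar_swap.
    have := @negpar_merge s _ _ l t0 x0; rewrite negpar_swap und1.
    case E: (negpar s (_ + _ :: l)) => /= H; [exists true|exists false].
      by split=> // w0; clear -w0 x0 t0; lia.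
    case/esym/andP: H => ne H; split=> // w0.
    by clear -ne w0; lia.
  have [c1 [cc1 same_disc wt1]] := merge_wt dep_par rF xF xr same c.
  exists c1; rewrite -/t' wt1; split => //.
    by rewrite add0r; case: hs.
  by move=> _; case: hs.
Qed.

(** The colorings [flip F (eta eps) c] give the blocks outside the references
    all possible signs. If v is a correct output, the sign of the discrepancy is that
    of the color of v, which depends on the sign of one block only, or of none. *)
Lemma parity_stop Rs Z F c o : parity_state Rs Z F c -> odd #|V| ->
  (forall c', same_answers par F c c' -> correct_output c' o) ->
  #|[set t in ~: F | (t \notin refs Rs F) && (0 < wt F c t)]| <= 1.
Proof.
move=> [rF und _] oddV ok; set N := [set t in _ | _].
case: o ok => [v|] ok; last first.
  have [|v] := @disc_neq0_majority _ c.
    by move=> D0; have := odd_disc c setT; rewrite D0 cardsT oddV.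
  by rewrite (negbTE (ok c (@same_answers_refl _ par F c) v)).
rewrite leqNgt; apply/negP => N2.
(* The block of t is flipped so as to get discrepancy of sign eps t. *)
pose eta (eps : pred V) t :=
  [&& t \notin refs Rs F, 0 < wt F c t & ((disc c (blk F t) < 0)%R (+) eps t)].
have discE eps : disc (flip F (eta eps) c) setT =
    (\sum_(t in ~: F) ref_disc Rs F c t + signed_sum (free_wt Rs F c) eps (enum (~: F)))%R.
  rewrite (disc_flip_setT dep_par) // /signed_sum big_enum -big_split /=.
  apply: eq_bigr => t _; rewrite /eta /ref_disc /free_wt /wt.
  case: (t \in refs Rs F) => /=; first by rewrite expr0 mul1r mulr0 addr0.
  case: posnP => [w0|w0] /=.
    by rewrite (_ : disc c (blk F t) = 0%R) ?mulr0 ?addr0 //; lia.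
  rewrite add0r; case: (eps t); case: ltP => h; rewrite ?expr0 ?expr1 /=; lia.
have winner eps : (\sum_(t in ~: F) ref_disc Rs F c t +
    signed_sum (free_wt Rs F c) eps (enum (~: F)) < 0)%R = ~~ (c v (+) eta eps (top F v)).
  have := ok _ (same_answers_flip dep_par (eta eps) c rF).
  rewrite /= majority_disc discE ffunE.
  by case: (_ (+) _); rewrite /sg /=; move: (_ + _)%R => D; lia.
move: und; rewrite /undecided; apply/negP.
have has_free t : t \in N -> free_wt Rs F c t = wt F c t.
  by rewrite /free_wt inE => /and3P [_ /negbTE ->].
case vR: (top F v \in refs Rs F).
  (* The color of v does not depend on eps. *)
  rewrite (@negpar_const _ _ (~~ c v)) ?enum_uniq //.
    by move=> eps; rewrite winner /eta vR addbF.
  have /card_gt0P [t tN] : 0 < #|N| by apply: leq_trans N2.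
  apply/hasP; exists t; first by move: tN; rewrite mem_enum inE => /and3P [].
  by rewrite has_free //; move: tN; rewrite inE => /and3P [].
case: (posnP (wt F c (top F v))) => [v0|v0].
  (* Flipping a block of weight 0 changes the color of v but not the total. *)
  have := ok _ (same_answers_flip dep_par (pred1 (top F v)) c rF).
  have := ok _ (@same_answers_refl _ par F c).
  rewrite /= !majority_disc ffunE /= eqxx addbT.
  have -> : disc (flip F (pred1 (top F v)) c) setT = disc c setT.
    rewrite (disc_flip_setT dep_par) // (disc_setT dep_par c rF).
    apply: eq_bigr => t _ /=; case: eqP => [->|_]; last by rewrite expr0 mul1r.
    by move: v0; rewrite /wt => v0; rewrite (_ : disc _ _ = 0%R) ?mulr0 //; lia.
  by case: (c v); rewrite /sg /=; lia.
have vN : top F v \in N by rewrite !inE vR v0 (top_notin dep_par).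
have vE : top F v \in enum (~: F) by rewrite mem_enum inE (top_notin dep_par).
rewrite (negpar_perm _ (perm_map _ (perm_to_rem vE))).
rewrite (@negpar_const_at _ _ (fun d => ~~ (c v (+) ((disc c (blk F (top F v)) < 0)%R (+) d)))) //.
- by rewrite -(perm_uniq (perm_to_rem vE)) enum_uniq.
- by rewrite has_free.
- move=> eps; rewrite /signed_sum -(perm_big _ (perm_to_rem vE)) /= -/(signed_sum _ _ _).
  by rewrite winner /eta vR v0.
have /card_gt0P [t] : 0 < #|N :\ top F v|.
  by move: N2; rewrite (cardsD1 (top F v)) vN; lia.
rewrite in_setD1 => /andP [tv tN]; apply/hasP; exists t.
  rewrite mem_rem_uniq ?enum_uniq // !inE tv mem_enum.
  by move: tN; rewrite inE => /and3P [].
by rewrite has_free //; move: tN; rewrite inE => /and3P [].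
Qed.

End ParityPhase.

(** * Blocks of weight zero left over from the first phase *)

Section StaleBlocks.
Variables (V : finType) (r : V) (par : V -> V) (dep : V -> nat).
Hypothesis dep_par : forall v, v != r -> dep v = (dep (par v)).+1.
Notation top := (top par dep).
Notation blk := (blk par dep).
Notation wt := (wt par dep).

Definition zero_set (F : {set V}) c := [set v | wt F c (top F v) == 0].

(** Marked blocks have positive weight. *)
Lemma zero_set_unmarked (X F : {set V}) c v :
  tame r par dep X F c -> v \in zero_set F c -> v \notin X.
Proof.
move=> [rF ok]; rewrite inE => /eqP w0; apply/negP => vX.
have := ok _ (top_notin dep_par rF v); rewrite /fit /fits w0 ltnn /=.
case: eqP => // /eqP; rewrite cards_eq0 => /eqP /setP /(_ v).
by rewrite !inE eqxx vX.
Qed.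

Lemma top_mono (F1 F : {set V}) v : r \notin F1 -> r \notin F -> F1 \subset F ->
  top F (top F1 v) = top F v.
Proof.
move=> rF1 rF sub; elim/(ancestor_ind dep_par): v => v IH.
have [vF|vF] := boolP (v \in F1); last by rewrite (top_id par dep vF).
rewrite (top_par dep_par rF1 vF) IH ?(mem_neq_root rF1) //.
by rewrite -(top_par dep_par rF) // (subsetP sub).
Qed.

Lemma iter_top (F : {set V}) u : r \notin F ->
  exists2 j, iter j par u = top F u &
    forall i, i <= j -> top F (iter i par u) = top F u.
Proof.
move=> rF; elim/(ancestor_ind dep_par): u => u IH.
have [uF|uF] := boolP (u \in F); last first.
  exists 0; first by rewrite /= top_id.
  by move=> i; rewrite leqn0 => /eqP ->.
have [j ju iu] := IH (mem_neq_root rF uF).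
exists j.+1; first by rewrite iterSr ju -(top_par dep_par).
case=> [//|i] ij; rewrite iterSr (iu i ij).
by rewrite (top_par dep_par rF uF).
Qed.

Variables (X F1 F : {set V}) (c1 : coloring V).
Hypotheses (tm : tame r par dep X F1 c1) (rX : r \in X).
Hypotheses (rF : r \notin F) (sF : F1 \subset F).

(** Such a block is a union of blocks that had weight 0 in the coloring c1, when
    the answered edges were F1. *)
Definition stale t := blk F t \subset zero_set F1 c1.

Lemma zero_set_neq_root v : v \in zero_set F1 c1 -> v != r.
Proof. by move=> vZ; apply: contraTneq (zero_set_unmarked tm vZ) => ->; rewrite rX. Qed.

(** Among the former blocks that make up t, a deepest one had weight 0, hence
    another block hanging below it. That one does not belong to t now, so the edge
    between them is still unanswered. *)
Lemma stale_child t : t \notin F -> stale t ->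
  exists s, [/\ s \notin F, s != r & top F (par s) = t].
Proof.
move=> tF st; have rF1 := tm.1.
have tP : (t \notin F1) && (top F t == t).
  by rewrite top_id // eqxx (contra (subsetP sF t)).
case: (@arg_maxnP _ t (fun u => (u \notin F1) && (top F u == t)) dep tP).
move=> t1 /andP [t1F1 /eqP t1t] max1.
have t1Z : t1 \in zero_set F1 c1 by apply: (subsetP st); rewrite inE t1t.
have wt1 : wt F1 c1 t1 = 0 by move: t1Z; rewrite inE top_id // => /eqP.
have [_ [s [sF1 sr st1]]] := zero_blk_child dep_par tm t1F1 (zero_set_neq_root t1Z) wt1.
have pst : top F (par s) = t by rewrite -(top_mono (par s) rF1 rF sF) st1.
exists s; split=> //; apply/negP => sF'.
have := max1 s; rewrite sF1 (top_par dep_par rF sF') pst eqxx => /(_ isT).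
rewrite (dep_par sr) -st1 => h.
by have := leq_trans h (dep_top dep_par rF1 (par s)); rewrite ltnn.
Qed.

(** Descend through [stale_child] until a block that is not stale is met;
    the path back up from its top p runs through stale blocks only. *)
Lemma stale_below t : t \notin F -> stale t ->
  exists p d, [/\ p \notin F, ~~ stale p, p != r, 0 < d & iter d par p = t /\
    forall i, 0 < i <= d -> iter i par p \in zero_set F1 c1].
Proof.
pose M := \max_v dep v.
have leM v : dep v <= M by apply: (leq_bigmax (F := dep)).
move: {2}(M - dep t) (leqnn (M - dep t)) => k; elim: k t => [|k IH] t tk tF st.
all: have [s [sF' sr sp]] := stale_child tF st.
all: have := dep_top dep_par rF (par s); rewrite sp => dts.
  exfalso; have := leM s; rewrite (dep_par sr).
  by move: tk dts; clear; lia.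
have [j jt it] := iter_top (par s) rF; rewrite sp in jt it.
have iZ i : i <= j -> iter i par (par s) \in zero_set F1 c1.
  by move=> ij; apply: (subsetP st); rewrite inE it.
have [ss|ss] := boolP (stale s); last first.
  exists s, j.+1; split => //; split; first by rewrite iterSr.
  by case=> // i /=; rewrite ltnS -/(iter i.+1 par s) iterSr => /iZ.
have [|p [d [pF ps pr d0 [ds dZ]]]] := IH s _ sF' ss.
  by have := leM s; rewrite (dep_par sr); move: tk dts; clear; lia.
exists p, (j.+1 + d); split => //.
split; first by rewrite iterD ds iterSr.
move=> i /andP [i0 ijd]; have [id|di] := leqP i d; first by apply: dZ; rewrite i0.
have -> : i = (i - d.+1).+1 + d by move: di; clear; lia.
by rewrite iterD ds iterSr; apply: iZ; move: ijd; clear; lia.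
Qed.

Variables (L i0 : nat).
Hypotheses (L0 : 0 < L) (spaced : forall v, dep v %% L = i0 %% L -> v \in X).

(** The path above p runs through consecutive depths and avoids the marked
    vertices, which fill a residue class of depths modulo L. *)
Lemma stale_below_near p d :
  p != r -> (forall i, 0 < i <= d -> iter i par p \in zero_set F1 c1) -> d < L.
Proof.
move=> pr dZ.
have depi i : i <= d -> dep p = dep (iter i par p) + i.
  elim: i => [|i IH] id; first by rewrite addn0.
  have ir : iter i par p != r.
    case: i id IH => [//|i] id IH; by apply: zero_set_neq_root; apply: dZ; move: id; clear; lia.
  by rewrite (IH (ltnW id)) (dep_par ir) /= addSnnS.
rewrite ltnNge; apply/negP => Ld.
have dL := depi L Ld.
(* i is the residue of dep p - i0 modulo L, taken in 1, ..., L. *)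
pose i := ((dep p + L * i0 - i0).-1 %% L).+1.
have iL : i <= L by rewrite ltn_mod.
have := zero_set_unmarked tm (dZ i _); rewrite /= (leq_trans iL Ld) => /(_ isT).
rewrite spaced //; have := depi i (leq_trans iL Ld).
set y := iter i par p => Ey.
apply/eqP; rewrite -(eqn_modDr i) -Ey.
rewrite /i -addn1 addnA addnC addnA -modnDmr modn_mod modnDmr.
set b := (_ - _).-1.
have -> : (1 + i0 + b = dep p + L * i0).
  rewrite /b; have : i0 <= L * i0 by rewrite leq_pmull.
  have : L <= dep p by rewrite dL leq_addl.
  by move: L0; clear; lia.
by rewrite mulnC modnMDl || rewrite addnC mulnC modnMDl.
Qed.

(** By [stale_below] and [stale_below_near] each stale block is
    reached from a top p other than r that is not stale by climbing d steps with
    0 < d < L. *)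
Lemma card_tops_le :
  #|~: F| <= #|[set t in ~: F | ~~ stale t]| +
             L.-1 * #|[set t in ~: F | ~~ stale t] :\ r|.
Proof.
set NT := [set t in _ | _].
rewrite (cardsD1 r) -/NT.
suff ZTle : #|[set t in ~: F | stale t]| <= L.-1 * #|NT :\ r|.
  rewrite -cardsD1 -(cardsID NT (~: F)).
  apply: leq_add; first by apply: subset_leq_card; apply: subsetIr.
  apply: leq_trans ZTle; apply: subset_leq_card; apply/subsetP => t.
  by rewrite !inE; case: (t \in F); case: (stale t).
pose g (pd : V * 'I_(L.-1)) := iter pd.2.+1 par pd.1.
have -> : L.-1 * #|NT :\ r| = #|setX (NT :\ r) [set: 'I_(L.-1)]|.
  by rewrite cardsX cardsT card_ord mulnC.
apply: leq_trans (leq_imset_card g _); apply: subset_leq_card.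
apply/subsetP => t; rewrite !inE => /andP [tF st].
have [p [d [pF ps pr d0 [<- dZ]]]] := stale_below tF st.
have dL := stale_below_near pr dZ.
have dL' : d.-1 < L.-1 by move: d0 dL; clear; lia.
apply/imsetP; exists (p, Ordinal dL'); first by rewrite !inE pr pF ps.
by change (iter d par p = iter d.-1.+1 par p); rewrite prednK.
Qed.

Lemma root_not_stale : r \in [set t in ~: F | ~~ stale t].
Proof.
rewrite !inE rF; apply/subsetP => sub.
by have := zero_set_neq_root (sub r (mem_blk_top _ _ rF)); rewrite eqxx.
Qed.

End StaleBlocks.

(** * Entering the parity phase *)

Section Start.
Variables (V : finType) (r : V) (par : V -> V) (dep : V -> nat).
Hypothesis dep_par : forall v, v != r -> dep v = (dep (par v)).+1.
Notation top := (top par dep).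
Notation blk := (blk par dep).
Notation wt := (wt par dep).
Notation flip := (flip par dep).

Variables (X F : {set V}) (c : coloring V).
Hypotheses (tm : tame r par dep X F c) (rX : r \in X).

(** The candidates for the weights outside the reference blocks: the block
    of the root is always a reference. *)
Definition free_of_weight w := [set t in ~: F | (t != r) && (wt F c t == w)].

(** Hence the marked blocks have total weight at most four times the number of
    marks. *)
Lemma sum_marks : \sum_(t in ~: F) #|blk F t :&: X| = #|X|.
Proof.
rewrite -[RHS]sum1_card [RHS](partition_big (top F) (mem (~: F))) /=; last first.
  by move=> v _; rewrite inE (top_notin dep_par tm.1).
apply: eq_bigr => t _; rewrite -sum1_card; apply: eq_bigl => v.
by rewrite !inE andbC.
Qed.

Lemma wt_le t : t \notin F -> wt F c t <=
  4 * #|blk F t :&: X| + (t \in free_of_weight 1) + 2 * (t \in free_of_weight 2).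
Proof.
move=> tF; have := tm.2 _ tF; rewrite /fit /fits !inE tF.
case: eqP => [k0|_]; last by move=> /andP [_ h]; rewrite -addnA; apply: leq_trans h (leq_addr _ _).
have -> : t != r.
  apply/eqP => tr; move/eqP: k0; rewrite cards_eq0 tr => /eqP /setP /(_ r).
  by rewrite !inE rX -tr top_id // eqxx.
by case: ifP => _ /eqP ->; rewrite ?k0 //; case: (odd _).
Qed.

Lemma wt_root : 0 < wt F c r <= 4 * #|X|.
Proof.
have := tm.2 _ tm.1; rewrite /fit /fits; case: eqP => [|_ /andP [-> h]].
  move/eqP; rewrite cards_eq0 => /eqP /setP /(_ r).
  by rewrite !inE rX top_id ?eqxx // tm.1.
by apply: leq_trans h _; rewrite leq_mul2l subset_leq_card ?subsetIr.
Qed.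

Lemma wt_small t : t \notin F -> wt F c t <= maxn 2 (4 * #|X|).
Proof.
move=> tF; have := tm.2 _ tF; rewrite /fit /fits.
case: eqP => [_ /eqP ->|_ /andP [_ h]].
  by rewrite leq_max; case: (odd #|_|) => //; case: (odd _).
apply: leq_trans h _; rewrite leq_max leq_mul2l.
by rewrite (subset_leq_card (subsetIr _ _)) !orbT.
Qed.

(** Only marked blocks have a weight above 2. *)
Lemma tot_wt_le :
  tot_wt par dep F c <= 4 * #|X| + #|free_of_weight 1| + 2 * #|free_of_weight 2|.
Proof.
have E w : #|free_of_weight w| = \sum_(t in ~: F) (t \in free_of_weight w).
  rewrite -sum1_card [RHS]big_mkcond [LHS]big_mkcond /=; apply: eq_bigr => t _.
  by rewrite !inE; case: (t \in F).
rewrite -sum_marks !E !big_distrr -!big_split /=; apply: leq_sum => t.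
by rewrite inE => /wt_le.
Qed.

(** The set A consists of the blocks that serve as references together with
    that of the root. It leaves an even number of blocks of weight 1 and its
    positive weight raises the reference discrepancy to at least 2, both of which
    [negpar_start] asks for. *)
Lemma choose_refs k :
  2 ^ k.+1 + 4 <= #|free_of_weight 1| + 2 * #|free_of_weight 2| ->
  exists A : {set V}, [/\ A \subset free_of_weight 1 :|: free_of_weight 2,
    #|A| <= 2, 0 < \sum_(t in A) wt F c t <= 2,
    ~~ odd #|free_of_weight 1 :\: A| &
    2 ^ k <= #|free_of_weight 1 :\: A|./2 + #|free_of_weight 2 :\: A|].
Proof.
set O := free_of_weight 1; set T := free_of_weight 2 => big.
have pow : 2 ^ k.+1 = 2 * 2 ^ k by rewrite expnS.
have OT u : u \in O -> u \notin T.
  by rewrite !inE => /and3P [_ _ /eqP ->]; rewrite /= !andbF.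
have wO u : u \in O -> wt F c u = 1 by rewrite !inE => /and3P [_ _ /eqP].
have wT u : u \in T -> wt F c u = 2 by rewrite !inE => /and3P [_ _ /eqP].
have [odO|evO] := boolP (odd #|O|).
  have /card_gt0P [u uO] : 0 < #|O| by case: #|O| odO.
  exists [set u]; split.
  - by rewrite sub1set inE uO.
  - by rewrite cards1.
  - by rewrite big_set1 wO.
  - by move: odO; rewrite (cardsD1 u) uO /=.
  - have -> : T :\: [set u] = T.
      by apply/setP => t; rewrite !in_setD in_set1; case: eqP => //= ->; rewrite (negbTE (OT u uO)).
    move: odO big; rewrite (cardsD1 u O) uO; move: pow; clear; lia.
have [O0|] := posnP #|O|.
  have /card_gt0P [u uT] : 0 < #|T| by move: big; rewrite O0; clear; lia.
  exists [set u]; split.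
  - by rewrite sub1set inE uT orbT.
  - by rewrite cards1.
  - by rewrite big_set1 wT.
  - have -> : O :\: [set u] = set0 by move/eqP: O0; rewrite cards_eq0 => /eqP ->; rewrite set0D.
    by rewrite cards0.
  - by move: big; rewrite O0 (cardsD1 u T) uT; move: pow; clear; lia.
case/card_gt0P => u uO.
have /card_gt0P [u' u'O] : 0 < #|O :\ u| by move: evO; rewrite (cardsD1 u O) uO; case: #|_|.
have := u'O; rewrite in_setD1 => /andP [u'u u'O1].
have DE : O :\: [set u; u'] = O :\ u :\ u'.
  by apply/setP => t; rewrite !in_setD !in_set1 in_set2 negb_or andbCA andbA.
exists [set u; u']; split.
- by apply/subsetP => t; rewrite in_set2 inE => /orP [] /eqP ->; rewrite ?uO ?u'O1.
- by rewrite cards2; case: (_ != _).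
- rewrite big_setU1 ?in_set1 1?eq_sym //= big_set1 !wO //.
- by move: evO; rewrite DE (cardsD1 u O) uO (cardsD1 u' (O :\ u)) u'O /= negbK.
- have -> : T :\: [set u; u'] = T.
    apply/setP => t; rewrite in_setD in_set2.
    case: (eqVneq t u) => [->|]; first by rewrite (negbTE (OT u uO)).
    by case: (eqVneq t u') => [->|] //; rewrite (negbTE (OT u' u'O1)).
  move: evO big; rewrite DE (cardsD1 u O) uO (cardsD1 u' (O :\ u)) u'O.
  by move: pow; clear; lia.
Qed.

(** The references are the root and the blocks of [choose_refs], flipped so
    that their discrepancies are positive and add up. *)
Lemma start_state k : 4 * #|X| + 4 <= 2 ^ k.+1 ->
  2 ^ k.+2 < tot_wt par dep F c <= 2 ^ k.+2 + 3 -> odd (tot_wt par dep F c) ->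
  exists Rs : {set V}, #|Rs| <= 3 /\
    exists c', [/\ same_answers par F c c', forall t, wt F c' t = wt F c t &
      undecided par dep Rs F c'].
Proof.
move=> fewX totk oddtot; have rF := tm.1.
have [|A [sA cA wA evA bigA]] := @choose_refs k.
  by move: tot_wt_le fewX totk; rewrite (expnS 2 k.+1); clear; lia.
have rA : r \notin A.
  by apply/negP => /(subsetP sA); rewrite !inE eqxx /= !andbF.
pose Rs := r |: A.
have RsF t : t \in Rs -> t \notin F.
  rewrite in_setU1 => /orP [/eqP -> //|/(subsetP sA)].
  by rewrite !inE => /orP [] /andP [].
have refsE : refs par dep Rs F = Rs.
  apply/setP => t; apply/imsetP/idP => [[u uR ->]|tR].
    by rewrite top_id // RsF.
  by exists t; rewrite ?top_id // RsF.
exists Rs; split; first by rewrite cardsU1 rA; move: cA; clear; lia.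
(* All reference discrepancies are made nonnegative. *)
pose c' := flip F (fun t => (t \in Rs) && (disc c (blk F t) < 0)%R) c.
exists c'.
have wtE t : wt F c' t = wt F c t.
  by rewrite /wt disc_flip; case: (_ && _); rewrite ?expr0 ?expr1 ?mul1r ?mulN1r ?abszN.
split=> //; first exact (same_answers_flip dep_par _ _ rF).
have refE t : ref_disc par dep Rs F c' t = (if t \in Rs then wt F c t else 0)%N%:Z%R.
  rewrite /ref_disc refsE; case: ifP => // tR.
  by rewrite disc_flip tR /= signed_abs.
pose s := \sum_(t in ~: F) (if t \in Rs then wt F c t else 0).
have sE : s = wt F c r + \sum_(t in A) wt F c t.
  rewrite /s -big_mkcondr /= -(big_setU1 _ rA) /=; apply: eq_bigl => t.
  by rewrite inE; case: (boolP (t \in Rs)) => [/RsF ->|_]; rewrite ?andbF.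
have freeE t : free_wt par dep Rs F c' t = if t \in Rs then 0 else wt F c t.
  by rewrite /free_wt refsE wtE.
rewrite /undecided (eq_bigr _ (fun t _ => refE t)) -(big_morph Posz PoszD (erefl (Posz 0))).
rewrite -/s (eq_map freeE).
have sumE : s + sumn [seq if t \in Rs then 0 else wt F c t | t <- enum (~: F)] =
            tot_wt par dep F c.
  rewrite sumnE big_map big_enum /= -big_split /=; apply: eq_bigr => t _.
  by case: (t \in Rs); rewrite ?addn0.
have countE w : 0 < w ->
    count_mem w [seq if t \in Rs then 0 else wt F c t | t <- enum (~: F)] =
    #|free_of_weight w :\: A|.
  move=> w0; rewrite count_map -sum1_count big_enum_cond /= -sum1_card.
  apply: eq_bigl => t; rewrite !inE.
  case: (eqVneq t r) => /= [_|_].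
    by rewrite !andbF (ltn_eqF w0) andbF.
  by case: (t \in A); rewrite ?(ltn_eqF w0) ?andbF.
have /andP [wr0 wrX] := wt_root.
apply: (@negpar_start k); rewrite ?countE ?sumE //.
by rewrite sE; move: wA wr0 wrX fewX; clear; lia.
Qed.

End Start.

(** * Odd order *)

(** The least of the L class sizes is at most their average. *)
Lemma sparse_residue (T : finType) (f : T -> nat) L : 0 < L ->
  exists2 i, i < L & L * #|[set v | f v %% L == i]| <= #|T|.
Proof.
move=> L0.
have [/existsP [i le]|none] := boolP [exists i : 'I_L, L * #|[set v | f v %% L == i]| <= #|T|].
  by exists i.
have sumE : \sum_(i < L) #|[set v | f v %% L == i]| = #|T|.
  rewrite -[RHS]sum1_card (partition_big (fun v => Ordinal (ltn_pmod (f v) L0)) predT) //=.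
  apply: eq_bigr => i _; rewrite -sum1_card; apply: eq_bigl => v.
  by rewrite inE -val_eqE.
have : \sum_(i < L) #|T|.+1 <= \sum_(i < L) L * #|[set v | f v %% L == i]|.
  apply: leq_sum => i _; rewrite ltnNge; apply: contra none => le.
  by apply/existsP; exists i.
by rewrite -big_distrr /= sumE sum_nat_const card_ord leq_pmul2l // ltnn.
Qed.

Section OddTree.
Variables (V : finType) (e : rel V) (r : V) (par : V -> V) (dep : V -> nat).
Hypothesis rt : rooting e r par dep.
Let dep_par : forall v, v != r -> dep v = (dep (par v)).+1.
Proof. by case: rt. Qed.
Notation top := (top par dep).
Notation blk := (blk par dep).
Notation wt := (wt par dep).
Notation flip := (flip par dep).

(** With odd order there is a majority, and an output v is refuted by turning
    all other blocks against the block of v, which is outweighed by them. *)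
Lemma light_blocks_stop (F : {set V}) c o w : r \notin F -> odd #|V| ->
  (forall t, t \notin F -> wt F c t <= w) -> 2 * w < tot_wt par dep F c ->
  ~ (forall c', same_answers par F c c' -> correct_output c' o).
Proof.
move=> rF oddV light heavy ok; case: o ok => [v|] ok; last first.
  have [|v] := @disc_neq0_majority _ c.
    by move=> D0; have := odd_disc c setT; rewrite D0 cardsT oddV.
  by rewrite (negbTE (ok c (@same_answers_refl _ par F c) v)).
have tvF : top F v \notin F := top_notin dep_par rF v.
pose S := \sum_(t in ~: F | t != top F v) wt F c t.
(* Every other block gets the sign opposite to the color of v. *)
pose eps t := (t != top F v) && (0 < sg (c v) * disc c (blk F t))%R.
have epsE : disc (flip F eps c) setT = (disc c (blk F (top F v)) - sg (c v) * S%:Z)%R.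
  rewrite (disc_flip_setT dep_par) // (bigD1 (top F v)) ?inE //= {1}/eps eqxx expr0 mul1r.
  congr (_ + _)%R; rewrite /S (big_morph Posz PoszD (erefl (Posz 0))) mulr_sumr -sumrN.
  apply: eq_bigr => t /andP [_ tt]; rewrite /eps tt /= /wt.
  case: (c v); rewrite /sg /= ?mul1r ?mulN1r; case: ltP => h;
    rewrite ?expr0 ?expr1; move: h; clear; lia.
have := ok _ (same_answers_flip dep_par eps c rF).
rewrite /= majority_disc ffunE {1}/eps eqxx addbF epsE.
have := light _ tvF; rewrite {1}/wt.
move: heavy {epsE}; rewrite /tot_wt (bigD1 (top F v)) ?inE //= -/S {1}/wt.
move: S (disc _ _) => S d.
by case: (c v); rewrite /sg /=; clear; lia.
Qed.

(** The adversary follows the first strategy while the total weight is at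
    least 2^(k+2) + 5, and the parity strategy thereafter. While the first one
    lasts, no block outweighs the others, so the algorithm cannot stop
    ([light_blocks_stop]). *)
Lemma odd_rooted_lower a : odd #|V| -> 65 < #|V| -> solves_majority e a ->
  exists c, #|V| - 65 <= num_queries a c.
Proof.
move=> oddV V65 [qa ok];
have [i i20 sparse] := @sparse_residue V dep 20 isT.
pose X := r |: [set v | dep v %% 20 == i].
have rX : r \in X by rewrite setU11.
have [k [kV fewX]] : exists k, 2 ^ k.+2 < #|V| /\ 4 * #|X| + 4 <= 2 ^ k.+1.
  have /andP [lo hi] := trunc_log_bounds (isT : 1 < 2) (ltn_trans (isT : 0 < 65) V65).
  set j := trunc_log 2 #|V| in lo hi.
  have j6 : 6 <= j.
    by rewrite -ltnS -(ltn_exp2l (m := 2)) //; apply: ltn_trans hi; apply: leq_ltn_trans V65.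
  (* 2^j is the largest power of 2 up to the number of vertices, and the marks are
     few enough since j is at least 6. *)
  exists (j - 2); have jE : j = (j - 2).+2 by move: j6; clear; lia.
  rewrite -jE; split => //.
    rewrite ltn_neqAle lo andbT; apply: contraTneq oddV => <-.
    by rewrite oddX; case: (j) j6.
  have leX : #|X| <= #|[set v | dep v %% 20 == i]|.+1.
    by rewrite cardsU1; case: (_ \notin _).
  have E1 : 2 ^ j.+1 = 128 * 2 ^ (j - 6) by rewrite -[128]/(2 ^ 7) -expnD; congr (2 ^ _); move: j6; clear; lia.
  have E2 : 2 ^ (j - 2).+1 = 32 * 2 ^ (j - 6) by rewrite -[32]/(2 ^ 5) -expnD; congr (2 ^ _); move: j6; clear; lia.
  have : 0 < 2 ^ (j - 6) by rewrite expn_gt0.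
  move: hi sparse leX; rewrite E1 E2.
  move: (2 ^ (j - 6)) #|X| #|[set v | _]| #|V|; clear; lia.
(* F1 and c1 are the answers and the coloring at the start of the parity phase. *)
pose parity (F : {set V}) (c : coloring V) :=
  exists (Rs F1 : {set V}) (c1 : coloring V),
    [/\ #|Rs| <= 3, tame r par dep X F1 c1, F1 \subset F &
        parity_state r par dep Rs (zero_set par dep F1 c1) F c].
pose P F c := tame r par dep X F c /\ 2 ^ k.+2 + 5 <= tot_wt par dep F c \/ parity F c.
have enter F c : tame r par dep X F c -> 2 ^ k.+2 < tot_wt par dep F c ->
    exists2 c', same_answers par F c c' & P F c'.
  move=> tm W; have [big|small] := leqP (2 ^ k.+2 + 5) (tot_wt par dep F c).
    by exists c; [exact: same_answers_refl | left].
  have oddW : odd (tot_wt par dep F c) by rewrite /tot_wt (odd_sum_wt dep_par) ?tm.1.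
  have [|Rs [cRs [c' [cc' same und]]]] := start_state dep_par tm rX fewX _ oddW.
    by move: oddW W small; rewrite (expnS 2 k.+1); clear; lia.
  exists c' => //; right; exists Rs, F, c; split => //.
  split; [exact: tm.1 | exact: und | move=> t tF tR w0].
  by apply/subsetP => v; rewrite !inE => /eqP ->; rewrite -same w0.
have step F c x : P F c -> x \notin F -> x != r ->
    exists2 c', same_answers par F c c' & P (x |: F) c'.
  move=> PFc xF xr; case: PFc => [[tm W]|[Rs [F1 [c1 [cRs tm sub st]]]]].
    have [c1 cc1 [tm1 W1]] := tame_step dep_par tm xF xr.
    have [|c2 cc2 P2] := enter _ _ tm1; first by move: W W1; clear; lia.
    exists c2 => //; apply: same_answers_trans cc1 _ => v vF.
    by apply: cc2; rewrite in_setU1 vF orbT.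
  have [c2 cc2 st2] := parity_step dep_par st xF xr.
  exists c2 => //; right; exists Rs, F1, c1; split => //.
  by apply: subset_trans sub _; apply: subsetUr.
have stop F c o : P F c -> #|F| < #|V| - 65 ->
    ~ (forall c', same_answers par F c c' -> correct_output c' o).
  case=> [[tm W] _|[Rs [F1 [c1 [cRs tm sub st]]]] fewF okF].
    apply: (light_blocks_stop tm.1 oddV (wt_small tm)).
    by apply: leq_trans W; move: fewX; rewrite (expnS 2 k.+1); clear; lia.
  have few1 := parity_stop dep_par st oddV okF.
  have [rF _ zero] := st.
  have spaced v : dep v %% 20 = i %% 20 -> v \in X.
    by rewrite (modn_small i20) !inE => ->; rewrite eqxx orbT.
  have le := card_tops_le dep_par tm rX rF sub (isT : 0 < 20) spaced.
  have rNT := root_not_stale dep_par tm rX rF.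
  set NT := [set t in _ | _] in le rNT.
  (* The blocks that are not stale: the reference blocks and at most one other. *)
  have few4 : #|NT| <= 4.
    apply: leq_trans (leq_add (leq_trans (leq_imset_card _ _) cRs : #|refs par dep Rs F| <= 3) few1).
    apply: leq_trans (leq_card_setU _ _); apply: subset_leq_card.
    apply/subsetP => t; rewrite !inE => /andP [tF].
    case tR: (t \in refs par dep Rs F) => //= nst; rewrite tF lt0n.
    by apply: contra nst => /eqP w0; apply: zero; rewrite ?tR.
  have := cardsD1 r NT; rewrite rNT.
  move: few4 le fewF (cardsC F) V65.
  by move: #|NT| #|NT :\ r| #|F| #|~: F| #|V|; clear; lia.
have [tm0 W0] := tame0 r par dep X [ffun=> true].
have [|c0 _ P0] := enter _ _ tm0; first by rewrite W0.
have [c _] := adversary rt step stop P0 qa (fun c' _ => ok c').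
by rewrite cards0; exists c.
Qed.

End OddTree.

Theorem theorem1p1 (V : finType) (e : rel V) (n : nat) :
  is_tree e -> #|V| = n ->
  (~~ odd n -> m e = n - 1) /\ (odd n -> n - 65 <= m e).
Proof.
move=> tr <-; have [r [par [dep rt]]] := tree_rooting tr.
have [[a ok maxa] upper] := m_least (tree_solvable rt).
split=> [evenV|oddV].
  have [c lower] := even_tree_lower tr evenV ok.
  by apply/eqP; rewrite eqn_leq upper (leq_trans lower).
have [small|V65] := leqP #|V| 65; first by rewrite (eqnP small).
have [c lower] := odd_rooted_lower rt oddV V65 ok.
exact: leq_trans lower (maxa c).
Qed.
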